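(* Let $\mathcal{X}$ and $\mathcal{Y}$ be bounded $mm$-fields over $B$. Then, for any $1\le p\le\infty$, $$\lim_{n\to\infty}d_{W,p}(\mathcal{D}_{\mathcal{X}}^n,\mathcal{D}_{\mathcal{Y}}^n)=d_{W,p}(\mathcal{D}_{\mathcal{X}},\mathcal{D}_{\mathcal{Y}})=d_{GW,\infty}(\mathcal{X},\mathcal{Y}).$$
   Context: A Polish space means a complete separable metric space. An $mm$-field $\mathcal{X}=(X,B,\pi_X,\mu_X)$ over a Polish space $(B,d_B)$ consists of a Polish space $(X,d_X)$, a $1$-Lipschitz map $\pi_X\colon X\to B$ and a Borel probability measure $\mu_X$ on $X$. It is bounded if $X$ has finite diameter. Put $m_{X,Y}(x,y,x',y'):=|d_X(x,x')-d_Y(y,y')|$, $d_{X,Y}(x,y):=d_B(\pi_X(x),\pi_Y(y))$, and let $C(\mu_X,\mu_Y)$ be the set of Borel probability measures on $X\times Y$ with marginals $\mu_X,\mu_Y$. Then $$d_{GW,\infty}(\mathcal{X},\mathcal{Y}):=\inf_{P\in C(\mu_X,\mu_Y)}\max\left\{\frac12\sup_{\mathrm{supp}(P\otimes P)}m_{X,Y},\ \sup_{\mathrm{supp}P}d_{X,Y}\right\}.$$ Let $\mathcal{R}^n$ be the set of $(r_{ij})\in\mathbb{R}^{n\times n}$ with $r_{ij}=r_{ji}$, $r_{ii}=0$, $r_{ik}\le r_{ij}+r_{jk}$, and $\mathcal{R}$ the analogous set of infinite matrices in $\mathbb{R}^{\mathbb{N}\times\mathbb{N}}$ with the coarsest topology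 making all projections onto northwest $n\times n$ blocks continuous. Let $\mathcal{R}_B^n:=\mathcal{R}^n\times B^n$ and $\mathcal{R}_B:=\mathcal{R}\times B^\infty$ (product topology, $B^\infty=B^{\mathbb{N}}$). On $\mathcal{R}_B$ consider the extended metric $$\rho\big((r_{ij},b_i),(r'_{ij},b'_i)\big):=\max\Big(\tfrac12\sup_{i,j}|r_{ij}-r'_{ij}|,\ \sup_i d_B(b_i,b'_i)\Big),$$ which is used only to define Wasserstein distances, not the topology; $\rho_n$ on $\mathcal{R}_B^n$ is defined by the same formula with indices in $\{1,\dots,n\}$. Let $\mathcal{F}_{\mathcal{X}}\colon X^\infty\to\mathcal{R}_B$ be $(x_i)\mapsto\big((d_X(x_i,x_j)),(\pi_X(x_i))\big)$ and $\mathcal{F}^n_{\mathcal{X}}\colon X^n\to\mathcal{R}^n_B$ its finite analogue. Set $\mathcal{D}_{\mathcal{X}}:=(\mathcal{F}_{\mathcal{X}})_*(\mu_X^\infty)$ and $\mathcal{D}^n_{\mathcal{X}}:=(\mathcal{F}^n_{\mathcal{X}})_*(\mu_X^n)$ (product measures); similarly for $\mathcal{Y}$. $d_{W,p}(\mathcal{D}_{\mathcal{X}},\mathcal{D}_{\mathcal{Y}})$ is the $p$-Wasserstein distance with respect to $\rho$: the infimum over couplings $Q$ of $\mathcal{D}_{\mathcal{X}},\mathcal{D}_{\mathcal{Y}}$ of $(\int\rho^p\,dQ)^{1/p}$ for $p<\infty$, and of the $Q$-essential supremum of $\rho$ for $p=\infty$. $d_{W,p}(\mathcal{D}^n_{\mathcal{X}},\mathcal{D}^n_{\mathcal{Y}})$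 is defined likewise with respect to $\rho_n$. *)

(* Defs.v *)
From HB Require Import structures.
From mathcomp Require Import all_boot all_order all_algebra.
From mathcomp Require Import all_classical all_reals all_analysis.
From mathcomp Require Import measurable_realfun.

Set Implicit Arguments.
Unset Strict Implicit.
Unset Printing Implicit Defensive.

Import Order.TTheory GRing.Theory Num.Theory.
Import numFieldNormedType.Exports.

Local Open Scope classical_set_scope.
Local Open Scope ring_scope.
Local Open Scope ereal_scope.

Section product_content.
Context d (T : measurableType d) (R : realType) (m : probability T R).
Implicit Types (A : nat -> set T) (x : nat -> T) (n N : nat).

Definition box A : set (nat -> T) := [set x | forall i, A i (x i)].

Definition is_box N A :=
  (forall i, measurable (A i)) /\ (forall i, (N <= i)%N -> A i = setT).

Definition boxes : set (set (nat -> T)) :=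
  [set C | exists NA, is_box NA.1 NA.2 /\ C = box NA.2].

Let upd x n (y : T) : nat -> T := fun i => if i == n then y else x i.

(* Conditional volume of a box given the first n coordinates of x. *)
Let phi (NA : nat * (nat -> set T)) n x : \bar R :=
  \prod_(i < n) (\1_(NA.2 i) (x i))%:E * \prod_(n <= i < NA.1) m (NA.2 i).

Let phi_ge0 NA n x : 0 <= phi NA n x.
Proof.
apply: mule_ge0; apply: prode_ge0 => i _ //.
Qed.

Let eq_phi NA n x x' : (forall i, (i < n)%N -> x i = x' i) ->
  phi NA n x = phi NA n x'.
Proof. by move=> xx'; rewrite /phi; congr (_ * _); apply: eq_bigr => i _; rewrite xx'. Qed.

Let phi0 NA x : phi NA 0 x = \prod_(i < NA.1) m (NA.2 i).
Proof. by rewrite /phi big_ord0 mul1e big_mkord. Qed.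

Let phi_large NA n x : is_box NA.1 NA.2 -> (NA.1 <= n)%N ->
  phi NA n x = (\1_(box NA.2) x)%:E.
Proof.
move=> [mA AT] Nn; rewrite /phi [X in _ * X]big_geq// mule1 prodEFin; congr EFin.
rewrite indicE; have [xA|xA] := boolP (x \in _).
  rewrite big1// => i _; rewrite indicE mem_set//.
  by move: xA; rewrite inE.
have [i ni] : exists i, ~ NA.2 i (x i).
  by apply/existsNP => h; move/negP: xA; apply; rewrite inE.
have iN : (i < n)%N.
  by rewrite ltnNge; apply/negP => /(leq_trans Nn) /AT E; apply: ni; rewrite E.
rewrite (bigD1 (Ordinal iN))//= indicE memNset//= mul0r//.
Qed.

Let phiSE NA n x y : is_box NA.1 NA.2 ->
  phi NA n.+1 (upd x n y) =
  \prod_(i < n) (\1_(NA.2 i) (x i))%:E * \prod_(n.+1 <= i < NA.1) m (NA.2 i)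
  * (\1_(NA.2 n) y)%:E.
Proof.
move=> _; rewrite /phi big_ord_recr/= /upd eqxx muleAC; congr (_ * _ * _).
by apply: eq_bigr => i _; rewrite ltn_eqF.
Qed.

Let measurable_phi NA n x : is_box NA.1 NA.2 ->
  measurable_fun setT (fun y => phi NA n.+1 (upd x n y)).
Proof.
move=> NAb; rewrite (_ : (fun _ => _) = fun y => 
  (\prod_(i < n) (\1_(NA.2 i) (x i))%:E * \prod_(n.+1 <= i < NA.1) m (NA.2 i))
  * (\1_(NA.2 n) y)%:E); last by apply/funext => y; rewrite phiSE.
apply: measurable_funeM; apply/measurable_EFinP.
by apply: measurable_indic; apply NAb.1.
Qed.

Let phiS NA n x : is_box NA.1 NA.2 ->
  \int[m]_y phi NA n.+1 (upd x n y) = phi NA n x.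
Proof.
move=> NAb; under eq_integral do rewrite phiSE//.
have mA := NAb.1 n.
rewrite ge0_integralZl//=.
- rewrite integral_indic// setIT /phi -muleA; congr (_ * _).
  have [Nn|nN] := leqP NA.1 n.
    by rewrite !big_geq ?(leq_trans Nn)// mul1e NAb.2//; exact: probability_setT.
  by rewrite [RHS]big_ltn// muleC.
- by apply/measurable_EFinP; exact: measurable_indic.
- by apply: mule_ge0; apply: prode_ge0.
Qed.

(* Selecting one coordinate at a time, a strict inequality between the values
   of two families of boxes would propagate to a single point. *)
Lemma box_compare (a b : nat -> nat * (nat -> set T)) K :
  (forall k, is_box (a k).1 (a k).2) -> (forall k, is_box (b k).1 (b k).2) ->
  (forall x, exists M, \sum_(k < K) (\1_(box (b k).2) x)%:E <=
                  \sum_(k < M) (\1_(box (a k).2) x)%:E :> \bar R) ->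
  \sum_(k < K) \prod_(i < (b k).1) m ((b k).2 i) <=
  \sum_(k <oo) \prod_(i < (a k).1) m ((a k).2 i).
Proof.
move=> ab bb ba; rewrite leNgt; apply/negP => lt_ab.
pose P n x := \sum_(k <oo) phi (a k) n x < \sum_(k < K) phi (b k) n x.
have P0 : P 0%N (fun _ => point).
  rewrite /P; under eq_bigr do rewrite phi0.
  by under eq_eseriesr do rewrite phi0.
have step n x : exists y, P n x -> P n.+1 (upd x n y).
  have [Pnx|nP] := pselect (P n x); last by exists point.
  apply: contrapT => /forallNP h; move: Pnx; rewrite /P ltNge => /negP; apply.
  under eq_bigr => k _ do rewrite -phiS//.
  under eq_eseriesr => k _ do rewrite -phiS//.
  rewrite -ge0_integral_sum//; last first.
    by move=> k; exact: measurable_phi.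
  rewrite -integral_nneseries//; last first.
    by move=> k; exact: measurable_phi.
  apply: ge0_le_integral => //.
  - by move=> y _; apply: sume_ge0.
  - by apply: emeasurable_sum => k; exact: measurable_phi.
  - by apply: ge0_emeasurable_sum => // k _; exact: measurable_phi.
  - by move=> y _; rewrite leNgt; apply/negP => Py; apply: (h y).
have /choice[g gP] : forall nx : nat * (nat -> T), exists y,
    P nx.1 nx.2 -> P nx.1.+1 (upd nx.2 nx.1 y).
  by move=> [n x]; exact: step.
pose X := fix X n := if n is n'.+1 then upd (X n') n' (g (n', X n'))
                     else (fun _ => point).
have PX n : P n (X n) by elim: n => [//|n IH]; exact: (gP (n, X n)).
pose x i := X i.+1 i.
have Xx n i : (i < n)%N -> X n i = x i.
  elim: n => // n IH; rewrite ltnS leq_eqVlt => /orP[/eqP -> //|ilt].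
  by rewrite /= /upd ltn_eqF// IH.
have Px n : P n x.
  have := PX n; rewrite /P; under eq_bigr do rewrite (eq_phi _ (Xx n)).
  by under eq_eseriesr do rewrite (eq_phi _ (Xx n)).
have [M leM] := ba x.
pose n := (\sum_(k < K) (b k).1 + \sum_(k < M) (a k).1)%N.
have := Px n; rewrite /P ltNge => /negP; apply.
rewrite (eq_bigr (fun k : 'I_K => (\1_(box (b k).2) x)%:E)); last first.
  move=> k _; rewrite phi_large// /n (bigD1 k)//= -!addnA.
  exact: leq_addr.
apply: (le_trans leM).
rewrite (eq_bigr (fun k : 'I_M => phi (a k) n x)); last first.
  move=> k _; rewrite phi_large// /n [X in (_ + X)%N](bigD1 k)//= addnCA.
  exact: leq_addr.
rewrite -(big_mkord xpredT (fun k => phi (a k) n x)).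
by apply: nneseries_lim_ge.
Qed.


Let empty_box : nat * (nat -> set T) := (1%N, fun i => if i == 0%N then set0 else setT).

Let empty_boxP : is_box empty_box.1 empty_box.2.
Proof. by split=> [i|[]]//=; case: ifP. Qed.

Let empty_boxE : box empty_box.2 = set0.
Proof. by rewrite -subset0 => x /(_ 0%N). Qed.

Let vol (NA : nat * (nat -> set T)) : \bar R := \prod_(i < NA.1) m (NA.2 i).

Let vol_ge0 NA : 0 <= vol NA. Proof. by apply: prode_ge0. Qed.

Let vol_empty : vol empty_box = 0.
Proof. by rewrite /vol big_ord1/= measure0. Qed.

Let repr (C : set (nat -> T)) : nat * (nat -> set T) :=
  get [set NA | is_box NA.1 NA.2 /\ C = box NA.2].

Let reprP C : boxes C -> is_box (repr C).1 (repr C).2 /\ C = box (repr C).2.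
Proof. by move=> bC; exact: (getPex bC). Qed.

Let mu (C : set (nat -> T)) : \bar R := vol (repr C).

Let boxes0 : boxes set0.
Proof. by exists empty_box; rewrite empty_boxE. Qed.

Let boxesI : setI_closed boxes.
Proof.
move=> _ _ [[N A] [[/= mA AT] ->]] [[M B] [[/= mB BT] ->]].
exists (maxn N M, fun i => A i `&` B i); split=> /=.
  split=> i; first exact: measurableI.
  by rewrite geq_max => /andP[Ni Mi]; rewrite AT// BT// setTI.
by apply/seteqP; split=> x /= h; [move=> i; split; [exact: h.1|exact: h.2]|
  split=> i; have [] := h i].
Qed.

Let boxesD : semi_setD_closed boxes.
Proof.
move=> _ _ [[N A] [[/= mA AT] ->]] [[M B] [[/= mB BT] ->]].
pose C i := box (fun j => if (j < i)%N then A j `&` B j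
                     else if j == i then A j `\` B j else A j).
exists [set C i | i in `I_M]; split.
- exact/finite_image/finite_II.
- move=> _ [i /= iM <-]; eexists (maxn N M, _); split; last by reflexivity.
  split=> /= j; first by case: ifP => _; [|case: ifP => _]; [exact: measurableI|exact: measurableD|].
  rewrite geq_max => /andP[Nj Mj]; rewrite ltnNge (leq_trans (ltnW iM) Mj)/=.
  by rewrite gtn_eqF ?AT// (leq_trans iM Mj).
- apply/seteqP; split=> x /=.
    move=> [Ax nBx].
    have [i0 nBi0] : exists i, ~ B i (x i) by apply/existsNP.
    have ex : exists i, ~~ `[< B i (x i) >] by exists i0; apply/asboolPn.
    have [i /asboolPn nBi imin] := ex_minnP ex.
    have iM : (i < M)%N.
      by rewrite ltnNge; apply/negP => Mi; apply: nBi; rewrite BT.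
    exists (C i); first by exists i.
    move=> j; case: ltnP => [ji|ij].
      split=> //; apply: contrapT => nBj.
      by move: ji; rewrite ltnNge imin//; apply/asboolPn.
    by case: eqP => [->|].
  move=> [_ [i iM <-] Cx]; split.
    by move=> j; have := Cx j; case: ifP => _; [case|case: ifP => _ //; case].
  by move=> Bx; have := Cx i; rewrite ltnn eqxx => -[_]; apply; exact: Bx.
- have disj i j x : (i < j)%N -> C i x -> C j x -> False.
    move=> ij /(_ i); rewrite ltnn eqxx => -[_ nB] /(_ i).
    by rewrite ij => -[].
  move=> _ _ [i _ <-] [j _ <-] [x [Cix Cjx]].
  have [ij|ji|-> //] := ltngtP i j.
    by have := disj _ _ _ ij Cix Cjx.
  by have := disj _ _ _ ji Cjx Cix.
Qed.

Let pad (U : Type) (u v : U) (k : nat) : U := if k == 0%N then u else v.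

Let series_pad NA : \sum_(k <oo) vol (pad NA empty_box k) = vol NA.
Proof.
rewrite nneseries_recl//= eseries0 ?adde0// => -[]//= k _ _.
Qed.

Let vol_le NA NB : is_box NA.1 NA.2 -> is_box NB.1 NB.2 ->
  box NB.2 `<=` box NA.2 -> vol NB <= vol NA.
Proof.
move=> bA bB BA; rewrite -(series_pad NA).
have := @box_compare (pad NA empty_box) (fun _ => NB) 1.
rewrite big_ord1; apply => //; first by move=> [|k].
move=> x; exists 1%N; rewrite !big_ord1/= lee_fin !indicE.
by rewrite ler_nat; case: (boolP (x \in box NB.2)) => //; rewrite inE => /BA xA; rewrite mem_set.
Qed.

Let mu_box NA : is_box NA.1 NA.2 -> mu (box NA.2) = vol NA.
Proof.
move=> bA; have [] := @reprP (box NA.2); first by exists NA.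
move=> bR E; apply/eqP; rewrite eq_le; apply/andP; split; apply: vol_le => //.
  by rewrite -E.
by rewrite {1}E.
Qed.

Let mu_le (A B : nat -> set (nat -> T)) K :
  (forall k, boxes (A k)) -> (forall k, boxes (B k)) ->
  (forall x, exists M, \sum_(k < K) (\1_(B k) x)%:E <=
                  \sum_(k < M) (\1_(A k) x)%:E :> \bar R) ->
  \sum_(k < K) mu (B k) <= \sum_(k <oo) mu (A k).
Proof.
move=> bA bB h.
apply: (@box_compare (fun k => repr (A k)) (fun k => repr (B k)) K).
- by move=> k; have [] := reprP (bA k).
- by move=> k; have [] := reprP (bB k).
- move=> x; have [M hM] := h x; exists M.
  under eq_bigr do rewrite -(reprP (bB _)).2.
  by under [leRHS]eq_bigr do rewrite -(reprP (bA _)).2.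
Qed.

Let mu0 : mu set0 = 0.
Proof. by rewrite -empty_boxE mu_box// vol_empty. Qed.

Let mu_ge0 C : 0 <= mu C. Proof. exact: vol_ge0. Qed.

Let mu_semi_sigma_additive (F : nat -> set (nat -> T)) :
  (forall i, boxes (F i)) -> trivIset setT F -> boxes (\bigcup_n F n) ->
  (fun n => \sum_(0 <= i < n) mu (F i)) @ \oo --> mu (\bigcup_n F n).
Proof.
move=> bF tF bUF.
have cvgF : cvgn (fun n => \sum_(0 <= i < n) mu (F i)).
  by apply: is_cvg_nneseries.
suff -> : mu (\bigcup_n F n) = \sum_(k <oo) mu (F k) by exact: cvgF.
apply/eqP; rewrite eq_le; apply/andP; split.
  have := @mu_le F (fun _ => \bigcup_n F n) 1.
  rewrite big_ord1; apply => // x.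
  have [[j _ Fjx]|nF] := pselect ((\bigcup_n F n) x).
    exists j.+1; rewrite big_ord1 big_ord_recr/= !indicE !mem_set//; last by exists j.
    by rewrite leeDr// sume_ge0.
  by exists 0%N; rewrite big_ord1 big_ord0 indicE memNset.
apply: lime_le => //; apply: nearW => n; rewrite big_mkord.
have -> : mu (\bigcup_n F n) = \sum_(k <oo) mu (pad (\bigcup_n F n) set0 k).
  by rewrite nneseries_recl//= eseries0 ?adde0// => -[].
apply: mu_le => //; first by move=> [].
move=> x; exists 1%N; rewrite big_ord1/= /pad/=.
have [[j Fjx]|nF] := pselect (exists j : 'I_n, F j x).
  rewrite (bigD1 j)//= big1 ?adde0.
    by rewrite lee_fin !indicE !mem_set//; exists j.
  move=> i ij; rewrite indicE memNset// => Fix_.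
  by move/eqP: ij; apply; apply: val_inj; apply: (tF i j) => //; exists x.
by rewrite big1// => i _; rewrite indicE memNset// => Fi; apply: nF; exists i.
Qed.


Lemma box_measure_exists : exists M : {measure set (g_sigma_algebraType boxes) -> \bar R},
  forall N A, is_box N A -> M (box A) = \prod_(i < N) m (A i).
Proof.
pose pT : pointedType := nat -> T.
pose TS := HB.pack_for (semiRingOfSetsType default_measure_display) (Pointed.sort pT)
  (isSemiRingOfSets.Build default_measure_display pT boxes0 boxesI boxesD).
pose MU := HB.pack_for {measure set TS -> \bar R} (mu : set TS -> \bar R)
  (@isMeasure.Build _ TS R mu mu0 mu_ge0 mu_semi_sigma_additive).
exists (measure_extension MU : {measure set _ -> \bar R}) => N A bA.
have mA : measurable (box A : set TS) by exists (N, A).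
exact: etrans (measurable_mu_extE MU mA) (@mu_box (N, A) bA).
Qed.

End product_content.

Section product_measure.
Context (I : countType) d (T : measurableType d) (R : realType).

Definition coordinate_cylinders : set (set (I -> T)) :=
  [set C | exists i (A : set T), measurable A /\ C = [set x | A (x i)]].

Lemma product_measure_exists (m : probability T R) :
  exists P : probability (g_sigma_algebraType coordinate_cylinders) R,
    forall (s : seq I) (A : I -> set T), uniq s ->
      (forall i, measurable (A i)) ->
      P [set x | forall i, i \in s -> A i (x i)] = \prod_(i <- s) m (A i).
Proof.
have [M ME] := box_measure_exists m.
pose f (x : g_sigma_algebraType (@boxes _ T)) :
    g_sigma_algebraType coordinate_cylinders := fun i => x (pickle i).
have mf : measurable_fun setT f.
  apply: (@measurability _ _ _ _ setT f coordinate_cylinders) => // _ [_ [i [A [mA ->]]] <-].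
  apply: sub_sigma_algebra.
  exists ((pickle i).+1, fun j => if j == pickle i then A else setT); split.
    split=> j /=; first by case: ifP.
    by move=> ij; rewrite gtn_eqF.
  apply/seteqP; split=> x /=.
    by move=> [_ Ax] j; case: eqP => // ->.
  by move=> /(_ (pickle i)); rewrite eqxx.
have PE (s : seq I) (A : I -> set T) : uniq s -> (forall i, measurable (A i)) ->
    pushforward M f [set x | forall i, i \in s -> A i (x i)] =
    \prod_(i <- s) m (A i).
  move=> us mA.
  pose N := (\sum_(i <- s) (pickle i).+1)%N.
  have sN i : i \in s -> (pickle i < N)%N.
    move=> si; rewrite /N (big_rem i)//=; exact: leq_addr.
  pose B j := if @pickle_inv I j is Some i then if i \in s then A i else setT else setT.
  have BE i : i \in s -> B (pickle i) = A i.
    by move=> si; rewrite /B pickleK_inv si.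
  have BN j : j \notin map pickle s -> B j = setT.
    rewrite /B; case E : (@pickle_inv I j) => [i|//] js.
    case: ifP => // si; move/negP : js => []; apply/mapP; exists i => //.
    by have := @pickle_invK I j; rewrite E.
  have bB : is_box N B.
    split=> j; first by rewrite /B; case: pickle_inv => // i; case: ifP.
    move=> Nj; apply: BN; apply/mapP => -[i si ji].
    by have := sN _ si; rewrite -ji ltnNge Nj.
  rewrite /pushforward (_ : _ @^-1` _ = box B); last first.
    apply/seteqP; split=> x /=.
      move=> h j; have [/mapP[i si ->]|js] := boolP (j \in map pickle s).
        by rewrite BE//; exact: h.
      by rewrite BN.
    by move=> h i si; have := h (pickle i); rewrite BE.
  rewrite (ME N)// -(big_mkord xpredT (fun j => m (B j))).
  rewrite (bigID (fun j => j \in map pickle s))/= [X in _ * X]big1 ?mule1; last first.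
    by move=> j js; rewrite BN//; exact: probability_setT.
  rewrite -big_filter (perm_big (map pickle s)).
    by rewrite big_map; apply: eq_big_seq => i si; rewrite BE.
  apply: uniq_perm; first by rewrite filter_uniq// iota_uniq.
    by rewrite map_inj_uniq//; exact: (pcan_inj pickleK).
  move=> j; rewrite mem_filter mem_index_iota/=.
  have [/mapP[i si ->]|//] := boolP (j \in map pickle s).
  by rewrite sN.
pose P0 := pushforward M f.
pose P1 : {measure set (g_sigma_algebraType coordinate_cylinders) -> \bar R} := 
  measure_function_pushforward__canonical__measure_function_Measure M mf.
have P1T : P1 setT = 1.
  have := PE [::] (fun _ => setT) isT (fun=> measurableT).
  rewrite big_nil => <-; congr (P1 _); apply/seteqP; split => //.
pose P := HB.pack_for (probability (g_sigma_algebraType coordinate_cylinders) R)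
   (Measure.sort P1) (Measure_isProbability.Build _ _ _ P1 P1T).
by exists P.
Qed.

(* Determined by product_measureE, since the cylinders in that lemma form a
   pi-system generating the product sigma-algebra. *)
Definition product_measure (m : probability T R) :=
  projT1 (cid (product_measure_exists m)).

Lemma product_measureE (m : probability T R) (s : seq I) (A : I -> set T) :
  uniq s -> (forall i, measurable (A i)) ->
  product_measure m [set x | forall i, i \in s -> A i (x i)] =
  \prod_(i <- s) m (A i).
Proof. exact: (projT2 (cid (product_measure_exists m))). Qed.

End product_measure.

HB.mixin Record isSeparable T & Topological T := {
  separable_subproof : exists2 D : set T, countable D & dense D }.

(* completePseudoMetricType provides a base point: this only excludes the empty
   space, which carries no probability measure. *)
#[short(type="polishType")]
HB.structure Definition Polish (R : realType) :=
  { T of @CompletePseudoMetric R T & @Metric R T & isSeparable T }.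

Notation borel T := (g_sigma_algebraType (@open T)).

Record mmField (R : realType) (B : polishType R) := MMField {
  mm_space :> polishType R ;
  mm_map : mm_space -> B ;
  mm_map_lip : forall x y : mm_space,
    (mdist (mm_map x) (mm_map y) <= mdist x y :> R)%R ;
  mm_measure : probability (borel mm_space) R }.

Definition mm_bounded (R : realType) (B : polishType R) (X : mmField B) :=
  exists M : R, forall x y : X, (mdist x y <= M)%R.

(* Borel probability measures on T1 * T2 with marginals m1 and m2. *)
Definition couplings (R : realType) (T1 T2 : ptopologicalType)
    (m1 : set T1 -> \bar R) (m2 : set T2 -> \bar R) :
    set (probability (borel (T1 * T2)%type) R) :=
  [set P |
    (forall A : set (borel T1), measurable A -> P (fst @^-1` A) = m1 A) /\
    (forall A : set (borel T2), measurable A -> P (snd @^-1` A) = m2 A)].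

(* Lnorm with exponent +oo is the essential supremum. *)
Definition wasserstein (R : realType) (p : \bar R) (T1 T2 : ptopologicalType)
    (c : T1 * T2 -> \bar R) (m1 : set T1 -> \bar R) (m2 : set T2 -> \bar R) :
    \bar R :=
  ereal_inf [set 'N[Q]_p[c] | Q in couplings m1 m2].

Definition supp (R : realType) (T : topologicalType) (m : set T -> \bar R) :
    set T :=
  [set x | forall U, open U -> U x -> 0 < m U].

Section GromovWasserstein.
Context (R : realType) (B : polishType R) (X Y : mmField B).

Definition mXY (z : (X * Y) * (X * Y)) : R :=
  `|mdist z.1.1 z.2.1 - mdist z.1.2 z.2.2|%R.

Definition dXY (z : X * Y) : R := mdist (mm_map z.1) (mm_map z.2).

Definition dGWoo : \bar R :=
  ereal_inf [set
    maxe ((2^-1)%:E * ereal_sup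
             [set (mXY z)%:E | z in @supp R ((X * Y) * (X * Y))%type (P \x P)])
         (ereal_sup [set (dXY z)%:E | z in @supp R (X * Y)%type P])
  | P in couplings (mm_measure X) (mm_measure Y)].

End GromovWasserstein.

Section augmented_distance_matrices.
Context (R : realType).

Definition distmat_pred (I : Type) : set {ptws I * I -> R} :=
  [set r | [/\ forall i j, r (i, j) = r (j, i),
               forall i, r (i, i) = 0%R &
               forall i j k, (r (i, k) <= r (i, j) + r (j, k))%R]].

(* I is 'I_n for n x n matrices and nat for infinite ones. The topology is the
   subspace topology of the product topology; see distmat_continuousP. *)
Definition distmat (I : Type) := set_type (@distmat_pred I).

HB.instance Definition _ I := Topological.on (distmat I).

Lemma distmat_pred0 I : @distmat_pred I (fun=> 0%R).
Proof. by split=> // *; rewrite addr0. Qed.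

HB.instance Definition _ I :=
  isPointed.Build (distmat I) (SigSub (mem_set (@distmat_pred0 I))).

Lemma nw_block_pred n (r : distmat nat) :
  @distmat_pred 'I_n (fun ij => set_val r (val ij.1, val ij.2)).
Proof.
have [rC r0 rD] := set_valP r.
by split=> *; [exact: rC|exact: r0|exact: rD].
Qed.

Definition nw_block n (r : distmat nat) : distmat 'I_n :=
  SigSub (mem_set (nw_block_pred n r)).

(* The topology on infinite matrices is the coarsest one making all the
   northwest blocks continuous. *)
Lemma distmat_continuousP (S : topologicalType) (f : S -> distmat nat) :
  continuous f <-> forall n, continuous (@nw_block n \o f).
Proof.
have evalP (U : topologicalType) (J : Type) (h : U -> {ptws J -> R}) :
    continuous h <-> forall j, continuous (fun u => h u j).
  split=> [ch j u|ch u].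
    have /cvg_sup/(_ j) huj := ch u.
    by apply: cvg_trans (@initial_continuous _ R (fun f : J -> R => f j) (h u));
      apply: cvg_app huj.
  apply/cvg_sup => j.
  exact: (@continuous_comp_initial _ _ R (fun f : J -> R => f j) h (ch j) u).
have distP (U : topologicalType) I (g : U -> distmat I) :
    continuous g <-> forall ij, continuous (fun u => set_val (g u) ij : R).
  rewrite -(@evalP U (I * I)%type (set_val \o g)); split=> [cg u|].
    apply: continuous_comp; first exact: cg.
    exact: (@initial_continuous _ {ptws I * I -> R} set_val).
  exact: continuous_comp_initial.
split=> [/distP cf n|cf].
  by apply/distP => ij; exact: (cf (val ij.1, val ij.2)).
apply/distP => -[i j].
pose n := (maxn i j).+1.
have iN : (i < n)%N by rewrite ltnS leq_maxl.
have jN : (j < n)%N by rewrite ltnS leq_maxr.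
by have /distP/(_ (Ordinal iN, Ordinal jN)) := cf n.
Qed.

Context (B : polishType R).

Definition augmented (I : Type) := (distmat I * {ptws I -> B})%type.

HB.instance Definition _ I := Topological.on (augmented I).
HB.instance Definition _ I := isPointed.Build (augmented I) (point, fun=> point).

(* For I = 'I_0 the suprema are over the empty set, hence junk; this only
   affects the term n = 0 of the sequence whose limit is considered. *)
Definition rho (I : Type) (z : augmented I * augmented I) : \bar R :=
  maxe
    ((2^-1)%:E * ereal_sup
       [set (`|set_val z.1.1 ij - set_val z.2.1 ij|%R)%:E | ij in [set: I * I]])
    (ereal_sup [set (mdist (z.1.2 i) (z.2.2 i))%:E | i in [set: I]]).

End augmented_distance_matrices.

Section distance_matrix_distribution.
Context (R : realType) (B : polishType R) (X : mmField B).

Lemma mdist_distmat I (x : I -> X) :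
  @distmat_pred R I (fun ij => mdist (x ij.1) (x ij.2)).
Proof.
by split=> *; [exact: metric_sym|exact: mdistxx|exact: metric_triangle].
Qed.

Definition augmented_dist (I : Type) (x : I -> X) : augmented B I :=
  (SigSub (mem_set (mdist_distmat x)), fun i => mm_map (x i)).

Definition dist_distribution (I : countType) : set (augmented B I) -> \bar R :=
  @pushforward _ _
    (g_sigma_algebraType (@coordinate_cylinders I _ (borel X)))
    (borel (augmented B I)) R
    (product_measure I (mm_measure X)) (@augmented_dist I).

End distance_matrix_distribution.

Definition dW (R : realType) (B : polishType R) (p : \bar R) (I : countType)
    (X Y : mmField B) : \bar R :=
  wasserstein p (@rho R B I) (@dist_distribution R B X I)
    (@dist_distribution R B Y I).

(* Main.v *)
Require Import Defs.
From HB Require Import structures.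
From mathcomp Require Import all_boot all_order all_algebra.
From mathcomp Require Import all_classical all_reals all_analysis.
From mathcomp Require Import measurable_realfun ess_sup_inf.
From mathcomp Require Import ring lra.

Set Implicit Arguments.
Unset Strict Implicit.
Unset Printing Implicit Defensive.

Import Order.TTheory GRing.Theory Num.Theory.
Import numFieldNormedType.Exports.

Local Open Scope classical_set_scope.
Local Open Scope ring_scope.
Local Open Scope ereal_scope.

(** Both inequalities between the Wasserstein and the Gromov-Wasserstein distance
    are proved for samples indexed by an arbitrary countable type [I], so that
    finite and infinite distance matrices are treated at once.

    Upper bound ([dW_le_dGW]). Draw independent pairs [(x_i, y_i)] from a coupling
    [P] of the two measures. The matrices of [(x_i)] and [(y_i)] form a coupling of
    the two distributions. Almost surely every pair lies in the support of [P], and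
    the support of [P \x P] is the square of that support ([supp_product]), so that
    [rho] is almost surely at most the cost of [P], and so is its norm for every
    exponent.

    Lower bound ([dW_lower_bound]). Fix a real [c] below the Gromov-Wasserstein
    distance. Cut both spaces into countably many cells of diameter at most
    [1 / (k + 1)], for every [k], and call a finite sample representative if the
    frequencies of the first cells are close to their measures. If representative
    samples of [X] and [Y] could be paired with distortion below [c], however
    representative they are required to be, then a limit point of the empirical
    measures of the pairs would be a coupling of cost at most [c]
    ([coupling_of_samples], [representative_pairing]). Hence sufficiently
    representative samples have distortion at least [c]. By the weak law of large
    numbers long samples are representative with probability near [1]; the matrices
    of representative samples form a set that need not be measurable, but it has
    open neighbourhoods as small as desired. So under every coupling of the
    distributions [rho] is almost [c] with probability near [1], and its norm is
    almost [c] for every exponent [p >= 1] ([dW_ge]).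

    The limit coupling is built by hand. An ultrafilter turns the empirical
    measures into a finitely additive probability on the set of pairs. It loses no
    mass at infinity, because its values on the cells of [X] and of [Y] are the true
    measures. Nested cells are read off at random with these probabilities
    ([random_word]); points chosen in them form a Cauchy sequence, and its limit has
    the right distribution in both coordinates ([limit_point]). *)

(** * Countable bases and Borel sets *)

(* Makes the statements on [borel T] below applicable to products. *)
HB.instance Definition _ (T1 T2 : ptopologicalType) := Pointed.on (T1 * T2)%type.

(** The sets are indexed, so that countability of the basis is countability of
    the type [K]. *)
Definition is_basis (T : topologicalType) (K : Type) (b : K -> set T) :=
  (forall k, open (b k)) /\
  forall x O, open O -> O x -> exists k, b k x /\ b k `<=` O.

Section borel_measurability.
Context d (W : measurableType d).

Lemma borel_preimage (T : ptopologicalType) (f : W -> T) (O : set T) :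
  measurable_fun setT (f : W -> borel T) -> open O -> measurable (f @^-1` O).
Proof.
move=> mf oO; rewrite -[X in measurable X]setTI; apply: mf => //.
exact: sub_sigma_algebra.
Qed.

Lemma borel_measurable (T : ptopologicalType) (f : W -> T) :
  (forall O, open O -> measurable (f @^-1` O)) ->
  measurable_fun setT (f : W -> borel T).
Proof.
move=> mf.
apply: (@measurability _ _ W (borel T) setT f (@open T)) => // _ [A oA <-].
by rewrite setTI; exact: mf.
Qed.

(** Every open set is a countable union of basic ones. Without a countable
    basis the Borel sets of a product could exceed the product sigma-algebra,
    and the maps into products below would have no reason to be measurable. *)
Lemma measurable_fun_basis (T : ptopologicalType) (K : countType)
    (b : K -> set T) (f : W -> T) :
  is_basis b -> (forall k, measurable (f @^-1` b k)) ->
  measurable_fun setT (f : W -> borel T).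
Proof.
move=> [bo bP] mf; apply: borel_measurable => A oA.
pose U n : set W := if @unpickle K n is Some k then
  (if `[< b k `<=` A >] then f @^-1` b k else set0) else set0.
have -> : f @^-1` A = \bigcup_n U n.
  apply/seteqP; split=> w.
    move=> Aw; have [k [bk kA]] := bP _ _ oA Aw.
    by exists (pickle k) => //; rewrite /U pickleK asboolT.
  move=> [n _]; rewrite /U; case: unpickle => // k.
  by case: asboolP => // kA /kA.
apply: bigcup_measurable => n _; rewrite /U; case: unpickle => // k.
by case: ifP.
Qed.

Lemma measurable_all_seq (J : eqType) (l : seq J) (P : J -> set W) :
  (forall j, measurable (P j)) ->
  measurable [set w | forall j, j \in l -> P j w].
Proof.
move=> mP; elim: l => [|j l IH].
  by rewrite (_ : [set _ | _] = setT)//; apply/seteqP; split.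
rewrite (_ : [set _ | _] = P j `&` [set w | forall j, j \in l -> P j w]).
  exact: measurableI.
apply/seteqP; split=> w /=.
  by move=> h; split=> [|j' j'l]; apply: h; rewrite inE ?eqxx// j'l orbT.
by move=> [h1 h2] j'; rewrite inE => /predU1P[->//|]; exact: h2.
Qed.

End borel_measurability.

Lemma openX (T1 T2 : topologicalType) (U : set T1) (V : set T2) :
  open U -> open V -> open (U `*` V).
Proof.
move=> oU oV; rewrite openE => -[x y] [/= Ux Vy].
by exists (U, V) => //=; split; exact: open_nbhs_nbhs.
Qed.

Lemma is_basis_prod (T1 T2 : topologicalType) (K1 K2 : Type)
    (b1 : K1 -> set T1) (b2 : K2 -> set T2) :
  is_basis b1 -> is_basis b2 ->
  is_basis (fun k : K1 * K2 => b1 k.1 `*` b2 k.2).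
Proof.
move=> [bo1 h1] [bo2 h2]; split=> [k|[x y] O oO Oxy].
  exact: openX.
have : nbhs (x, y) O by apply: open_nbhs_nbhs.
move=> [[U V] /= [Ux Vy] UVO].
move: Ux; rewrite nbhsE => -[U' [oU' U'x] U'U].
move: Vy; rewrite nbhsE => -[V' [oV' V'y] V'V].
have [k1 [kx k1U]] := h1 _ _ oU' U'x.
have [k2 [ky k2V]] := h2 _ _ oV' V'y.
exists (k1, k2); split=> // -[x' y'] /= [h h']; apply: UVO; split => /=.
  by apply: U'U; exact: k1U.
by apply: V'V; exact: k2V.
Qed.

Lemma open_all_seq (T : topologicalType) (J : eqType) (l : seq J) (P : J -> set T) :
  (forall j, open (P j)) -> open [set t | forall j, j \in l -> P j t].
Proof.
move=> oP; elim: l => [|j l IH].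
  rewrite (_ : [set _ | _] = setT); first exact: openT.
  by apply/seteqP; split.
rewrite (_ : [set _ | _] = P j `&` [set t | forall j, j \in l -> P j t]).
  exact: openI.
apply/seteqP; split=> w /=.
  by move=> h; split=> [|j' j'l]; apply: h; rewrite inE ?eqxx// j'l orbT.
by move=> [h1 h2] j'; rewrite inE => /predU1P[->//|]; exact: h2.
Qed.

Lemma is_basis_ptws (J : choiceType) (S : topologicalType) (K : choiceType)
    (b : K -> set S) : is_basis b ->
  is_basis (fun (l : seq (J * K)) =>
    [set g : {ptws J -> S} | forall jk, jk \in l -> b jk.2 (g jk.1)]).
Proof.
move=> [bo bP]; pose C (l : seq (J * K)) :=
  [set g : {ptws J -> S} | forall jk, jk \in l -> b jk.2 (g jk.1)].
split=> [l|f A oA Af].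
  apply: (@open_all_seq {ptws J -> S} _ l (fun jk g => b jk.2 (g jk.1))) => jk.
  apply: (@open_comp {ptws J -> S} S (fun g => g jk.1)); last exact: bo.
  by move=> g _; exact: (@proj_continuous _ (fun=> S) jk.1 g).
(* The sets containing a cylinder around f form a filter that converges
   pointwise to f, hence one that contains all neighbourhoods of f. *)
pose F := filter_from [set l | C l f] C.
have FF : Filter F.
  apply: filter_from_filter; first by exists [::].
  move=> l l' lf l'f; exists (l ++ l').
    by move=> jk; rewrite mem_cat => /orP[/lf|/l'f].
  by move=> g h; split=> jk jkl; apply: h; rewrite mem_cat jkl ?orbT.
have Ff : F --> (f : {ptws J -> S}).
  apply/cvg_sup => j A' /=.
  rewrite (@nbhsE (initial_topology (fun g : J -> S => g j))).
  move=> [_ [[U oU <-] /= Uf] UA].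
  have [k [kf kU]] := bP _ _ oU Uf.
  exists [:: (j, k)]; first by move=> jk; rewrite inE => /eqP ->.
  by move=> g /(_ (j, k)); rewrite mem_head => /(_ isT) /kU /UA.
have [l lf lA] : F A by apply: Ff; apply: open_nbhs_nbhs.
by exists l; split.
Qed.

Lemma is_basis_initial (S : choiceType) (T : topologicalType) (f : S -> T) (K : Type)
    (b : K -> set T) : is_basis b ->
  is_basis (fun k => (f @^-1` b k) : set (initial_topology f)).
Proof.
move=> [bo bP]; split=> [k|x O [A oA <-] Ax].
  by exists (b k).
have [k [bk kA]] := bP _ _ oA Ax.
by exists k; split => // y /kA.
Qed.

Lemma is_basis_ball (R : realType) (T : pseudoMetricType R) (K : Type)
    (d : K -> T) :
  (forall x (e : R), (0 < e)%R -> exists k, ball (d k) e x) ->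
  is_basis (fun kn : K * nat => (ball (d kn.1) (kn.2.+1%:R^-1 : R)%R)°).
Proof.
move=> dP; split=> [k|x A oA Ax]; first exact: open_interior.
have : nbhs x A by apply: open_nbhs_nbhs.
rewrite -nbhs_ballE => -[e /= e0 eA].
have [n ne] : exists n : nat, (n.+1%:R^-1 < e / 2)%R.
  have : (0 < e / 2)%R by rewrite divr_gt0.
  by move=> /ltr_add_invr[n]; rewrite add0r; exists n.
have n0 : (0 < n.+1%:R^-1 / 2 :> R)%R by rewrite divr_gt0.
have [k kx] := dP x _ n0.
exists (k, n); split=> /=.
  rewrite /interior -nbhs_ballE; exists (n.+1%:R^-1 / 2)%R => //= y xy.
  by rewrite [n.+1%:R^-1%R]splitr; apply: ball_triangle xy.
apply: (subset_trans (@interior_subset _ _)) => y ky; apply: eA.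
rewrite (splitr e); apply: (@ball_triangle _ _ (d k)).
  apply: ball_sym; apply: le_ball kx; rewrite ler_pdivrMr//.
  by rewrite (le_trans (ltW ne))// ler_peMr ?ler1n// divr_ge0// ltW.
by apply: le_ball ky; exact: ltW.
Qed.

Lemma real_basis (R : realType) : exists b : rat * nat -> set R, is_basis b.
Proof.
eexists; apply: (@is_basis_ball R R rat ratr) => x e e0.
have [q] : exists q : rat, ratr q \in `]x, (x + e)%R[.
  by apply: rat_in_itvoo; rewrite ltrDl.
rewrite in_itv/= => /andP[xq qe]; exists q.
by rewrite -ball_normE/= gtr0_norm ?subr_gt0// ltrBlDl.
Qed.

Section polish.
Context (R : realType) (T : polishType R).

Lemma open_mdist (O : set T) x : open O -> O x ->
  exists2 e : R, (0 < e)%R & forall y, (mdist x y < e)%R -> O y.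
Proof.
move=> oO Ox.
have : nbhs x O by apply: open_nbhs_nbhs.
rewrite -nbhs_ballE => -[e /= e0 eO]; exists e => // y xy.
by apply: eO; rewrite ballEmdist.
Qed.

Lemma open_mball (x : T) (e : R) : open [set y | (mdist x y < e)%R].
Proof.
rewrite openE => y /= xy; rewrite /interior -nbhs_ballE.
exists (e - mdist x y)%R; rewrite /= ?subr_gt0// => z.
rewrite ballEmdist /= ltrBrDl; apply: le_lt_trans.
exact: metric_triangle.
Qed.

Lemma dense_seq : exists d : nat -> T,
  forall x (e : R), (0 < e)%R -> exists n, (mdist x (d n) < e)%R.
Proof.
have [D cD dD] := @separable_subproof R T.
have [f fD] : exists f : nat -> T, D `<=` range f.
  have /pfcard_geP[->|[g]] := cD; first by exists (fun=> point).
  exists (g : nat -> T) => x Dx.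
  by have [n _ <-] := @surj _ _ _ _ g x Dx; exists n.
exists f => x e e0.
have [|y [/= xy Dy]] := dD [set y | (mdist x y < e)%R] _ (open_mball _ _).
  by exists x; rewrite /= mdistxx.
by have [n _ ny] := fD _ Dy; exists n; rewrite ny.
Qed.

(** The balls around a dense sequence with radii [1 / (n + 1)]. *)
Lemma polish_basis : exists b : nat * nat -> set T, is_basis b.
Proof.
have [d dP] := dense_seq.
eexists; apply: (@is_basis_ball R T nat d) => x e e0.
by have [n xn] := dP x e e0; exists n; rewrite ballEmdist/= metric_sym.
Qed.

End polish.
(** * Measurability of distance matrices and of their distance *)

Lemma augmented_basis (R : realType) (B : polishType R) (I : countType) :
  exists (K : countType) (b : K -> set (augmented B I)), is_basis b.
Proof.
have [bR hR] := real_basis R; have [bB hB] := polish_basis B.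
pose hI := @is_basis_initial (distmat R I) _ set_val _ _
  (@is_basis_ptws (I * I)%type _ _ _ hR).
by do 2 eexists; exact: (is_basis_prod hI (@is_basis_ptws I _ _ _ hB)).
Qed.

Section borel_coordinates.
Context d (W : measurableType d).

Lemma borel_measurable_pair (T1 T2 : ptopologicalType) (K1 K2 : countType)
    (b1 : K1 -> set T1) (b2 : K2 -> set T2) (f1 : W -> T1) (f2 : W -> T2) :
  is_basis b1 -> is_basis b2 ->
  measurable_fun setT (f1 : W -> borel T1) ->
  measurable_fun setT (f2 : W -> borel T2) ->
  measurable_fun setT ((fun w => (f1 w, f2 w)) : W -> borel (T1 * T2)%type).
Proof.
move=> h1 h2 m1 m2;

apply: (@measurable_fun_basis _ W (T1 * T2)%type (K1 * K2)%type _ _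
  (is_basis_prod h1 h2)) => k.
apply: (measurableI (f1 @^-1` b1 k.1) (f2 @^-1` b2 k.2)); apply: borel_preimage => //.
  exact: h1.1.
exact: h2.1.
Qed.

Lemma borel_measurable_augmented (R : realType) (B : polishType R) (I : countType)
    (f : W -> augmented B I) :
  (forall i j, measurable_fun setT ((fun w => set_val (f w).1 (i, j)) : W -> borel R)) ->
  (forall i, measurable_fun setT ((fun w => (f w).2 i) : W -> borel B)) ->
  measurable_fun setT (f : W -> borel (augmented B I)).
Proof.
move=> m1 m2.
have [bR hR] := real_basis R; have [bB hB] := polish_basis B.
pose hI := @is_basis_initial (distmat R I) _ set_val _ _
  (@is_basis_ptws (I * I)%type _ _ _ hR).
apply: (@measurable_fun_basis _ W (augmented B I)
  (seq (I * I * (rat * nat)) * seq (I * (nat * nat)))%type _ _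
  (is_basis_prod hI (@is_basis_ptws I _ _ _ hB))) => -[k l].
apply: measurableI.
  apply: (measurable_all_seq k
    (P := fun jk w => bR jk.2 (set_val (f w).1 jk.1))) => -[[i j] n].
  by apply: (borel_preimage (m1 i j)); exact: hR.1.
apply: (measurable_all_seq l (P := fun jk w => bB jk.2 ((f w).2 jk.1))) => -[j n].
by apply: (borel_preimage (m2 j)); exact: hB.1.
Qed.

End borel_coordinates.

Lemma continuous_borel (T1 T2 : ptopologicalType) (f : T1 -> T2) :
  continuous f -> measurable_fun setT (f : borel T1 -> borel T2).
Proof.
move=> cf; apply: borel_measurable => O oO.
by apply: sub_sigma_algebra; move/continuousP: cf; exact.
Qed.

Lemma open_borel (T : ptopologicalType) (O : set T) :
  open O -> measurable (O : set (borel T)).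
Proof. exact: sub_sigma_algebra. Qed.

Lemma mdist_continuous (R : realType) (T : polishType R) :
  continuous (fun xy : T * T => mdist xy.1 xy.2 : R).
Proof.
move=> [x y] /=; apply/cvgrPdist_lt => e e0.
have e2 : (0 < e / 2)%R by rewrite divr_gt0.
exists ([set x' | (mdist x x' < e / 2)%R], [set y' | (mdist y y' < e / 2)%R]).
  by split; apply: open_nbhs_nbhs; split; rewrite /= ?mdistxx//; exact: open_mball.
move=> [x' y'] /= [xx yy]; rewrite (splitr e) ltr_norml; apply/andP; split.
  have := metric_triangle x' x y'; have := metric_triangle x y y'.
  rewrite (metric_sym x' x); lra.
have := metric_triangle x x' y; have := metric_triangle x' y' y.
rewrite (metric_sym y' y); lra.
Qed.

Section sample_measurability.
Context (R : realType) (B : polishType R) (X : mmField B) (I : countType).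

Lemma mm_map_continuous : continuous (@mm_map R B X).
Proof.
move=> x A; rewrite -nbhs_ballE => -[e /= e0 eA].
apply: (@filterS _ _ _ [set y | (mdist x y < e)%R]).
  by move=> y /= xy; apply: eA; rewrite ballEmdist/= (le_lt_trans (mm_map_lip _ _)).
by apply: open_nbhs_nbhs; split; rewrite /= ?mdistxx//; exact: open_mball.
Qed.

Lemma measurable_coordinate d (T : measurableType d) (i : I) :
  measurable_fun setT
    ((fun x => x i) : g_sigma_algebraType (@coordinate_cylinders I _ T) -> T).
Proof.
by move=> _ A mA; rewrite setTI; apply: sub_sigma_algebra; exists i, A.
Qed.

Lemma measurable_cylinders d (W : measurableType d) d' (T : measurableType d')
    (f : W -> I -> T) :
  (forall i, measurable_fun setT (fun w => f w i)) ->
  measurable_fun setT (f : W -> g_sigma_algebraType (@coordinate_cylinders I _ T)).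
Proof.
move=> mf.
apply: (@measurability _ _ W (g_sigma_algebraType (@coordinate_cylinders I _ T))
  setT f (@coordinate_cylinders I _ T)) => //.
by move=> _ [_ [i [A [mA ->]]] <-]; exact: (mf i).
Qed.

Lemma measurable_augmented_dist :
  measurable_fun setT
   (@augmented_dist R B X I :
     g_sigma_algebraType (@coordinate_cylinders I _ (borel X)) -> borel (augmented B I)).
Proof.
have [bX hX] := polish_basis X.
apply: borel_measurable_augmented => [i j|i] /=.
  have m1 := continuous_borel (@mdist_continuous R X).
  have m2 := borel_measurable_pair hX hX
    (@measurable_coordinate _ (borel X) i) (@measurable_coordinate _ (borel X) j).
  exact: measurableT_comp m1 m2.
have m1 := continuous_borel mm_map_continuous.
exact: measurableT_comp m1 (@measurable_coordinate _ (borel X) i).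
Qed.

End sample_measurability.
Section real_valued.
Context d (W : measurableType d) (R : realType).

Lemma borel_measurable_real (f : W -> R) :
  measurable_fun setT (f : W -> borel R) -> measurable_fun setT f.
Proof.
move=> mf; apply: (measurability _ (RGenOInfty.measurableE R)) => _ [_ [x ->] <-].
by rewrite setTI; apply: (borel_preimage mf); exact: interval_open.
Qed.

(** The supremum exceeds [x] exactly when one of countably many functions
    does. *)
Lemma measurable_ereal_sup (J : countType) (f : J -> W -> \bar R) :
  (forall j, measurable_fun setT (f j)) ->
  measurable_fun setT (fun w => ereal_sup [set f j w | j in [set: J]]).
Proof.
move=> mf; apply: (measurability _ (ErealGenOInfty.measurableE R)) => _ [_ [x ->] <-].
rewrite setTI.
pose U n : set W := if @unpickle J n is Some j then
  (f j @^-1` `]x%:E, +oo[) else set0.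
rewrite (_ : _ @^-1` _ = \bigcup_n U n); last first.
  apply/seteqP; split=> w /=; rewrite in_itv/= andbT.
    move=> /ereal_sup_gt[_ [j _ <-] xj]; exists (pickle j) => //.
    by rewrite /U pickleK/= in_itv/= andbT.
  move=> [n _]; rewrite /U; case: unpickle => // j /=; rewrite in_itv/= andbT => xj.
  by apply: (lt_le_trans xj); apply: ereal_sup_ubound; exists j.
apply: bigcup_measurable => n _; rewrite /U; case: unpickle => // j.
by rewrite -[X in measurable X]setTI; apply: mf => //; exact: emeasurable_itv.
Qed.

End real_valued.

Lemma continuous_distmat_entry (R : realType) (I : Type) (ij : I * I) :
  continuous (fun r : distmat R I => set_val r ij : R).
Proof.
move=> r.
have cv : {for r, continuous (set_val : distmat R I -> {ptws I * I -> R})}.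
  exact: (@initial_continuous _ {ptws I * I -> R} set_val).
apply: (@continuous_comp (distmat R I) {ptws I * I -> R} R set_val (fun f => f ij) r cv).
have /cvg_sup/(_ ij) h := @cvg_id {ptws I * I -> R} (nbhs (set_val r : {ptws I * I -> R})).
apply: cvg_trans (@initial_continuous _ R (fun f : I * I -> R => f ij) (set_val r)).
by apply: cvg_app h.
Qed.

Section rho_measurability.
Context (R : realType) (B : polishType R) (I : countType).
Local Notation AA := (borel (augmented B I * augmented B I)%type).

Lemma measurable_rho : measurable_fun setT (@rho R B I : AA -> \bar R).
Proof.
have cfst (T1 T2 : topologicalType) : continuous (@fst T1 T2) by move=> x; exact: cvg_fst.
have csnd (T1 T2 : topologicalType) : continuous (@snd T1 T2) by move=> x; exact: cvg_snd.
apply: measurable_maxe.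
  apply: measurable_funeM; apply: measurable_ereal_sup => ij.
  apply/measurable_EFinP; apply: measurableT_comp => //.
  apply: measurable_funB; apply: borel_measurable_real.
    apply: (@continuous_borel (augmented B I * augmented B I)%type R
      (fun z => set_val z.1.1 ij)) => z.
    apply: (@continuous_comp _ _ _ (fun z => z.1.1)
      (fun r : distmat R I => set_val r ij)).
      by apply: (@continuous_comp _ _ _ fst fst); [exact: cfst|exact: cfst].
    exact: continuous_distmat_entry.
  apply: (@continuous_borel (augmented B I * augmented B I)%type R
    (fun z => set_val z.2.1 ij)) => z.
  apply: (@continuous_comp _ _ _ (fun z => z.2.1)
    (fun r : distmat R I => set_val r ij)).
    by apply: (@continuous_comp _ _ _ snd fst); [exact: csnd|exact: cfst].
  exact: continuous_distmat_entry.
apply: measurable_ereal_sup => i; apply/measurable_EFinP; apply: borel_measurable_real.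
have [bB hB] := polish_basis B.
have m1 : measurable_fun setT ((fun z => z.1.2 i) : AA -> borel B).
  apply: (@continuous_borel (augmented B I * augmented B I)%type B
    (fun z => z.1.2 i)) => z.
  apply: (@continuous_comp _ _ _ (fun z => z.1.2) (fun f : {ptws I -> B} => f i)).
    by apply: (@continuous_comp _ _ _ fst snd); [exact: cfst|exact: csnd].
  exact: (@proj_continuous _ (fun=> B) i).
have m2 : measurable_fun setT ((fun z => z.2.2 i) : AA -> borel B).
  apply: (@continuous_borel (augmented B I * augmented B I)%type B
    (fun z => z.2.2 i)) => z.
  apply: (@continuous_comp _ _ _ (fun z => z.2.2) (fun f : {ptws I -> B} => f i)).
    by apply: (@continuous_comp _ _ _ snd snd); [exact: csnd|exact: csnd].
  exact: (@proj_continuous _ (fun=> B) i).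
exact: measurableT_comp (continuous_borel (@mdist_continuous R B))
  (borel_measurable_pair hB hB m1 m2).
Qed.

Lemma rho_ge0 (i : I) (z : augmented B I * augmented B I) : 0 <= rho z.
Proof.
rewrite /rho le_max; apply/orP; right.
apply: le_ereal_sup_tmp; exists (mdist (z.1.2 i) (z.2.2 i))%:E; first by exists i.
by rewrite lee_fin mdist_ge0.
Qed.

End rho_measurability.

(** * Image measures and infinite products *)

Lemma push_probability d d' (W : measurableType d) (T : measurableType d')
    (R : realType) (m : probability W R) (f : W -> T) :
  measurable_fun setT f ->
  exists P : probability T R, forall A, P A = m (f @^-1` A).
Proof.
move=> mf.
pose P1 : {measure set T -> \bar R} :=
  measure_function_pushforward__canonical__measure_function_Measure m mf.
have P1T : P1 setT = 1 by exact: (@probability_setT _ _ _ m).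
pose P := HB.pack_for (probability T R)
   (Measure.sort P1) (Measure_isProbability.Build _ _ _ P1 P1T).
by exists P.
Qed.

(** Two measures on the product that agree on finite rectangles agree; for
    the image of [product_measure I m] by [h], coordinate by coordinate, the
    rectangles are a matter of one factor at a time. *)
Lemma product_measure_preimage (I : countType) (R : realType) d d'
    (T : measurableType d) (T' : measurableType d') (m : probability T R)
    (m' : probability T' R) (h : T -> T') (mh : measurable_fun setT h) :
  (forall A, measurable A -> m (h @^-1` A) = m' A) ->
  forall C, measurable (C : set (g_sigma_algebraType (@coordinate_cylinders I _ T'))) ->
  product_measure I m ((fun x i => h (x i)) @^-1` C) = product_measure I m' C.
Proof.
move=> hm C mC.
have mH : measurable_fun setT ((fun x i => h (x i)) :
    g_sigma_algebraType (@coordinate_cylinders I _ T) ->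
    g_sigma_algebraType (@coordinate_cylinders I _ T')).
  apply: measurable_cylinders => i; apply: measurableT_comp => //.
  exact: measurable_coordinate.
have [P PE] := push_probability (product_measure I m) mH.
rewrite -PE.
pose G : set (set (I -> T')) := [set E | exists (s : seq I) (A : I -> set T'),
  [/\ uniq s, forall i, measurable (A i) & E = [set x | forall i, i \in s -> A i (x i)]]].
have GT : G setT.
  by exists [::], (fun=> setT); split => //; apply/seteqP; split.
pose CT := g_sigma_algebraType (@coordinate_cylinders I _ T').
apply: (@g_sigma_algebra_measure_unique _ R CT G _ (fun=> setT) _ _
  P (product_measure I m')) => //.
- move=> _ [s [A [_ mA ->]]].
  apply: (@measurable_all_seq _ CT I s (fun i x => A i (x i))) => i.
  by apply: sub_sigma_algebra; exists i, (A i).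
- by apply/seteqP; split => // x _; exists 0%N.
- move=> _ _ [s [A [us mA ->]]] [s' [A' [us' mA' ->]]].
  exists (undup (s ++ s')), (fun i => (if i \in s then A i else setT) `&`
     (if i \in s' then A' i else setT)); split; first exact: undup_uniq.
    by move=> i; apply: measurableI; case: ifP.
  apply/seteqP; split=> x /=.
    by move=> [h1 h2] i _; split; case: ifP => //; [exact: h1|exact: h2].
  by move=> a; split=> i si; have [] := a i; rewrite ?mem_undup ?mem_cat ?si ?orbT//.
- move=> _ [s [A [us mA ->]]].
  apply: (etrans (PE _)); apply/esym/(etrans (product_measureE m' us mA))/esym.
  apply: (etrans (@product_measureE I _ T R m s (fun i => h @^-1` (A i)) us _)).
    by move=> i; rewrite -[X in measurable X]setTI; exact: mh.
  by apply: eq_bigr => i _; exact: hm.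
- by move=> k; rewrite (le_lt_trans (probability_le1 _ _)) ?ltry.
- apply: sub_sigma_algebra2 mC => _ [i [A [mA ->]]].
  exists [:: i], (fun=> A); split => //.
  by apply/seteqP; split=> x /=; [move=> a j; rewrite inE => /eqP->|apply; rewrite mem_head].
Qed.
(** * Supports *)

Section support.
Context (R : realType) (T : ptopologicalType) (K : countType) (b : K -> set T).
Hypothesis hb : is_basis b.
Variable P : probability (borel T) R.

(** The complement of the support is the union of the null sets of a countable
    basis. *)
Lemma supp_setC :
  measurable (~` @supp R T P : set (borel T)) /\ P (~` @supp R T P) = 0.
Proof.
pose U n : set T := if @unpickle K n is Some k then
  (if P (b k) == 0 then b k else set0) else set0.
have -> : ~` @supp R T P = \bigcup_n U n.
  apply/seteqP; split=> [x /= nx|x [n _ Ux] sx].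
    have [V /not_implyP[oV /not_implyP[Vx /negP]]] := (existsNP _).2 nx.
    rewrite -leNgt => PV.
    have [k [kx kV]] := hb.2 _ _ oV Vx.
    exists (pickle k) => //; rewrite /U pickleK.
    have -> // : P (b k) == 0.
    rewrite eq_le measure_ge0 andbT (le_trans _ PV)// le_measure// ?inE//.
      by apply: open_borel; exact: hb.1.
    exact: open_borel.
  move: Ux; rewrite /U; case: unpickle => // k.
  case: eqP => // Pk kx.
  by have := sx _ (hb.1 k) kx; rewrite Pk ltxx.
have mU n : measurable (U n : set (borel T)).
  rewrite /U; case: unpickle => // k; case: ifP => // _.
  by apply: open_borel; exact: hb.1.
split; first exact: bigcup_measurable.
apply/negligibleP; first exact: bigcup_measurable.
apply: negligible_bigcup => n; apply/negligibleP => //.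
rewrite /U; case: unpickle => [k|]; last exact: measure0.
by case: eqP => // _; exact: measure0.
Qed.

Lemma supp_nonempty : @supp R T P !=set0.
Proof.
apply/set0P/eqP => s0; have [mS PS] := supp_setC.
move: PS; rewrite s0 setC0 => PS.
have := @probability_setT _ _ _ P; rewrite PS => /eqP.
by rewrite eq_sym onee_eq0.
Qed.

(** Rectangles form a basis of the square and their measure is a product. This
    is what reduces the distortion of a coupling, a supremum over the support of
    [P \x P], to independent draws from the support of [P]. *)
Lemma supp_product (z z' : T) :
  @supp R (T * T)%type (P \x P) (z, z') <-> @supp R T P z /\ @supp R T P z'.
Proof.
split=> [h|[hz hz'] U oU Uz].
  have PT : P setT = 1 by exact: probability_setT.
  split=> U oU Uz.
    have := h (U `*` setT) (openX oU openT) (conj Uz I).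
    rewrite (@product_measure1E _ _ (borel T) (borel T))//; last exact: open_borel.
    by rewrite [X in _ * X]PT mule1.
  have := h (setT `*` U) (openX openT oU) (conj I Uz).
  rewrite (@product_measure1E _ _ (borel T) (borel T))//; last exact: open_borel.
  by rewrite [X in X * _]PT mul1e.
have : nbhs (z, z') U by apply: open_nbhs_nbhs.
move=> [[V V'] /= [Vz V'z'] VU].
move: Vz; rewrite nbhsE => -[W [oW Wz] WV].
move: V'z'; rewrite nbhsE => -[W' [oW' Wz'] WV'].
have mU : measurable (U : set (borel T * borel T)%type).
  have := @borel_measurable_pair _ (borel T * borel T)%type T T K K b b fst snd hb hb
    measurable_fst measurable_snd.
  move=> /borel_preimage => /(_ _ oU); congr measurable.
  by apply/seteqP; split=> -[].
apply: (@lt_le_trans _ _ ((P \x P) (W `*` W'))).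
  rewrite (@product_measure1E _ _ (borel T) (borel T))//; [|exact: open_borel..].
  by rewrite mule_gt0//; [exact: hz|exact: hz'].
apply: le_measure; rewrite ?inE//.
  by apply: (@measurableX _ _ (borel T) (borel T)); exact: open_borel.
by move=> [x y] /= [Wx Wy]; apply: VU; split; [exact: WV|exact: WV'].
Qed.

End support.

(** * Bounds on Lp norms *)

Section norm_bounds.
Context d (W : measurableType d) (R : realType) (Q : probability W R).

Lemma Lnorm_le (p C : \bar R) (f : W -> \bar R) : 1 <= p -> 0 <= C ->
  measurable_fun setT f -> (\forall x \ae Q, `|f x| <= C) -> 'N[Q]_p[f] <= C.
Proof.
move=> p1 C0 mf fC.
have QT : Q setT = 1 by exact: probability_setT.
rewrite unlock /Lnorm; case: p p1 => [r r1|_|//].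
  have r0 : (0 < r)%R by rewrite (lt_le_trans ltr01).
  case: C C0 fC => [C|_ _|//]; last exact: leey.
  rewrite lee_fin => C0 fC.
  have -> : C%:E = (C%:E `^ r) `^ r^-1.
    by rewrite -poweRrM mulfV ?gt_eqF// poweRe1.
  apply: gt0_ler_poweR; rewrite ?invr_ge0 ?(ltW r0)//.
  - by rewrite in_itv/= leey andbT integral_ge0// => x _; exact: poweR_ge0.
  - by rewrite in_itv/= leey andbT lee_fin powR_ge0.
  have -> : C%:E `^ r = \int[Q]_x cst (C%:E `^ r) x.
    by rewrite integral_cst// [X in _ * X]QT mule1.
  apply: ae_ge0_le_integral => //.
  - by move=> x _; exact: poweR_ge0.
  - apply: (@measurableT_comp _ _ _ _ _ _ (fun x => x `^ r)) => //=.
      exact: measurable_poweR.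
    exact: measurableT_comp.
  - by move=> x _; exact: poweR_ge0.
  apply: filterS fC => x fxC _.
  apply: gt0_ler_poweR; rewrite ?(ltW r0)//.
  - by rewrite in_itv/= leey andbT abse_ge0.
  - by rewrite in_itv/= leey andbT lee_fin.
by rewrite ifT; [apply/ess_supP|rewrite [ltRHS]QT lte01].
Qed.

(** For finite [p], Markov's inequality gives [c * Q V `^ p^-1], which is at
    least [c * Q V] since [Q V <= 1] and [1 <= p]. *)
Lemma Lnorm_ge (p : \bar R) (c : R) (f : W -> \bar R) (V : set W) :
  1 <= p -> (0 <= c)%R -> measurable V ->
  measurable_fun setT f -> (forall x, V x -> c%:E <= f x) ->
  c%:E * Q V <= 'N[Q]_p[f].
Proof.
move=> p1 c0 mV mf fC.
have QT : Q setT = 1 by exact: probability_setT.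
have QV1 : Q V <= 1 by exact: probability_le1.
have QV0 : 0 <= Q V by exact: measure_ge0.
rewrite unlock /Lnorm; case: p p1 => [r r1|_|//].
  have r0 : (0 < r)%R by rewrite (lt_le_trans ltr01).
  apply: (@le_trans _ _ ((c%:E `^ r * Q V) `^ r^-1)).
    rewrite poweRM ?poweR_ge0// -poweRrM mulfV ?gt_eqF// poweRe1//.
    rewrite lee_wpmul2l ?lee_fin//.
    have QVf : Q V \is a fin_num by rewrite ge0_fin_numE// (le_lt_trans QV1) ?ltry.
    rewrite -(fineK QVf) poweR_EFin lee_fin.
    have /andP[f0 f1] : (0 <= fine (Q V) <= 1)%R by rewrite -!lee_fin fineK// QV0.
    have [->|fn0] := eqVneq (fine (Q V)) 0%R; first by rewrite powR_ge0.
    apply: ger1_powR; last by rewrite invf_le1.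
    by rewrite f1 andbT lt_neqAle eq_sym fn0.
  apply: gt0_ler_poweR; rewrite ?invr_ge0 ?(ltW r0)//.
  - by rewrite in_itv/= leey andbT mule_ge0// lee_fin powR_ge0.
  - by rewrite in_itv/= leey andbT integral_ge0// => x _; exact: poweR_ge0.
  have -> : c%:E `^ r * Q V = \int[Q]_(x in V) cst (c%:E `^ r) x.
    by rewrite integral_cst.
  have mfr : measurable_fun setT (fun x => `|f x| `^ r).
    apply: (@measurableT_comp _ _ _ _ _ _ (fun x => x `^ r)) => //=.
      exact: measurable_poweR.
    exact: measurableT_comp.
  apply: (@le_trans _ _ (\int[Q]_(x in V) `|f x| `^ r)).
    apply: ge0_le_integral => //.
    + by move=> x _; exact: poweR_ge0.
    + exact: measurable_funTS.
    move=> x Vx; apply: gt0_ler_poweR; rewrite ?(ltW r0)//.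
    - by rewrite in_itv/= leey andbT.
    - by rewrite in_itv/= leey andbT abse_ge0.
    by rewrite (le_trans (fC x Vx))// lee_abs.
  by apply: ge0_subset_integral => // x _; exact: poweR_ge0.
rewrite ifT; last by rewrite [ltRHS]QT lte01.
have [->|/eqP QV] := eqVneq (Q V) 0.
  rewrite mule0 ess_sup_gee//; first by rewrite [ltRHS]QT lte01.
  by apply: nearW => x /=; exact: abse_ge0.
apply: (@le_trans _ _ c%:E); first by rewrite -[leRHS]mule1 lee_wpmul2l ?lee_fin//.
rewrite leNgt; apply/negP => lt_c.
have := ess_sup_ge Q (abse \o f) => -[N [mN QN0 hN]].
apply: QV; apply/eqP; rewrite eq_le QV0 andbT -QN0; apply: le_measure; rewrite ?inE//.
move=> x Vx; apply: hN => /= h.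
have := le_lt_trans h lt_c; rewrite ltNge => /negP; apply.
by rewrite (le_trans (fC x Vx))// lee_abs.
Qed.

End norm_bounds.
(** * Independent samples of a coupling *)

(** Independent draws from [P], sent to [X] by [h], are independent draws from
    the measure of [X]. *)
Lemma dist_distribution_pushforward (R : realType) (B : polishType R)
    (X : mmField B) (I : countType) (T : ptopologicalType) (h : T -> X)
    (P : probability (borel T) R) :
  measurable_fun setT (h : borel T -> borel X) ->
  (forall A : set (borel X), measurable A -> P (h @^-1` A) = mm_measure X A) ->
  forall A : set (borel (augmented B I)), measurable A ->
  product_measure I P [set w | A (augmented_dist (fun i => h (w i)))] =
  dist_distribution X A.
Proof.
move=> mh hP A mA.
have mC := @measurable_augmented_dist R B X I measurableT A mA.
rewrite setTI in mC.
exact: (product_measure_preimage mh hP mC).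
Qed.

Section upper_bound.
Context (R : realType) (B : polishType R) (X Y : mmField B).

(** Independent draws from a coupling [P] of the two measures yield a coupling
    of the distributions of matrices, under which [rho] is almost surely at most
    the cost of [P], because almost surely all draws lie in the support of
    [P]. *)
Lemma dW_le_dGW (I : countType) (i0 : I) (p : \bar R) : 1 <= p ->
  dW p I X Y <= dGWoo X Y.
Proof.
move=> p1; apply: le_ereal_inf_tmp => _ [P [PX PY] <-].
set C := maxe _ _.
have [bX hX] := polish_basis X; have [bY hY] := polish_basis Y.
have hZ := is_basis_prod hX hY.
pose Z : ptopologicalType := (X * Y)%type.
have mfst : measurable_fun setT (fst : borel Z -> borel X).
  by apply: (@continuous_borel Z X fst) => z; exact: cvg_fst.
have msnd : measurable_fun setT (snd : borel Z -> borel Y).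
  by apply: (@continuous_borel Z Y snd) => z; exact: cvg_snd.
pose W := g_sigma_algebraType (@coordinate_cylinders I _ (borel Z)).
pose Phi (w : W) : augmented B I * augmented B I :=
  (augmented_dist (fun i => (w i).1), augmented_dist (fun i => (w i).2)).
have mmap (T : mmField B) (h : Z -> T) :
    measurable_fun setT (h : borel Z -> borel T) ->
    measurable_fun setT
      ((fun w => augmented_dist (fun i => h (w i))) : W -> borel (augmented B I)).
  move=> mh.
  have mc : measurable_fun setT ((fun w i => h (w i)) : W ->
      g_sigma_algebraType (@coordinate_cylinders I _ (borel T))).
    apply: measurable_cylinders => i; apply: measurableT_comp => //.
    exact: measurable_coordinate.
  exact: measurableT_comp (@measurable_augmented_dist R B T I) mc.
have [K [bA hA]] := augmented_basis B I.
have mPhi : measurable_fun setT (Phi : W -> borel (augmented B I * augmented B I)%type).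
  exact: (borel_measurable_pair hA hA (mmap _ _ mfst) (mmap _ _ msnd)).
have [Q QE] := push_probability (product_measure I P) mPhi.
apply: (@le_trans _ _ ('N[Q]_p[@rho R B I])).
  apply: ereal_inf_lbound; exists Q => //; split=> A mA; rewrite QE.
    exact: (dist_distribution_pushforward (I := I) mfst PX mA).
  exact: (dist_distribution_pushforward (I := I) msnd PY mA).
have dC z : @supp R Z P z -> (dXY z)%:E <= C.
  move=> hz; rewrite le_max; apply/orP; right.
  by apply: ereal_sup_ubound; exists z.
have mC z z' : @supp R Z P z -> @supp R Z P z' -> (2^-1)%:E * (mXY (z, z'))%:E <= C.
  move=> hz hz'; rewrite le_max; apply/orP; left.
  rewrite lee_wpmul2l ?lee_fin ?invr_ge0//.
  by apply: ereal_sup_ubound; exists (z, z') => //; apply/(supp_product hZ).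
apply: Lnorm_le => //.
- have [z hz] := supp_nonempty hZ P.
  by apply: le_trans (dC z hz); rewrite lee_fin mdist_ge0.
- exact: measurable_rho.
have mN : measurable ((fun z => `|rho z|) @^-1` `]C, +oo] :
    set (borel (augmented B I * augmented B I)%type)).
  rewrite -[X in measurable X]setTI; apply: measurableT_comp => //.
    exact: measurable_rho.
  exact: emeasurable_itv.
exists ((fun z => `|rho z|) @^-1` `]C, +oo]); split => //; last first.
  by move=> z /= /negP; rewrite -ltNge in_itv/= leey andbT.
apply: (etrans (QE _)).
have [mS PS] := supp_setC hZ P.
pose N (n : nat) : set W := if @unpickle I n is Some i then
  [set w | (~` @supp R Z P) (w i)] else set0.
have mN' n : measurable (N n).
  rewrite /N; case: unpickle => // i.
  by apply: sub_sigma_algebra; exists i, (~` @supp R Z P).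
have mB : measurable (\bigcup_n N n) by exact: bigcup_measurable.
have mpre : measurable (Phi @^-1` ((fun z => `|rho z|) @^-1` `]C, +oo])).
  by rewrite -[X in measurable X]setTI; exact: mPhi.
apply/eqP; rewrite eq_le measure_ge0 andbT.
have <- : product_measure I P (\bigcup_n N n) = 0.
  apply/negligibleP => //; apply: negligible_bigcup => n; apply/negligibleP => //.
  rewrite /N; case: unpickle => [i|]; last exact: measure0.
  have := @product_measureE I _ (borel Z) R P [:: i] (fun=> ~` @supp R Z P) isT (fun=> mS).
  rewrite big_seq1 PS => <-; congr (product_measure _ _ _).
  by apply/seteqP; split=> w /=; [move=> h j; rewrite inE => /eqP->|apply; rewrite mem_head].
apply: le_measure; rewrite ?inE//.
move=> w /=; rewrite in_itv/= leey andbT => Cw; apply: contrapT => nw.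
have sw i : @supp R Z P (w i).
  apply: contrapT => nsw; apply: nw; exists (pickle i) => //.
  by rewrite /N pickleK.
move: Cw; rewrite ltNge => /negP; apply.
rewrite gee0_abs; last exact: (rho_ge0 i0).
rewrite ge_max; apply/andP; split.
  have -> : C = (2^-1)%:E * (2%:E * C).
    by rewrite muleA -EFinM mulVf ?mul1e.
  rewrite lee_wpmul2l ?lee_fin ?invr_ge0//.
  apply: ge_ereal_sup => _ [[i j] _ <-].
  have := mC _ _ (sw i) (sw j).
  by rewrite lee_pdivrMl.
by apply: ge_ereal_sup => _ [i _ <-]; exact: (dC (w i)).
Qed.

End upper_bound.
(** * Limits of finitely additive probabilities *)

Section finitely_additive.
Context (R : realType) (S : Type).

Definition fin_add (nu : set S -> R) :=
  [/\ forall E, (0 <= nu E)%R, nu setT = 1%R &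
      forall E F, E `&` F = set0 -> nu (E `|` F) = (nu E + nu F)%R].

Section theory.
Variables (nu : set S -> R) (hnu : fin_add nu).

Lemma fin_add0 : nu set0 = 0%R.
Proof.
have [_ _ h] := hnu; have := h set0 set0 (setI0 _); rewrite setU0 => e.
by apply: (@addrI _ (nu set0)); rewrite -e addr0.
Qed.

Lemma fin_add_le E F : E `<=` F -> (nu E <= nu F)%R.
Proof.
move=> EF; have [h0 _ h] := hnu.
rewrite -(setDUK EF) h; first by rewrite lerDl h0.
by rewrite setDE setICA setICr setI0.
Qed.

Lemma fin_add_sum (V : nat -> set S) n :
  (forall i j s, V i s -> V j s -> i = j) ->
  (\sum_(i < n) nu (V i) = nu [set s | exists2 i, (i < n)%N & V i s])%R.
Proof.
move=> tV; have [_ _ h] := hnu; elim: n => [|n IH].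
  rewrite big_ord0 (_ : [set _ | _] = set0) ?fin_add0//.
  by apply/seteqP; split=> // s [].
rewrite big_ord_recr/= IH -h.
  congr nu; apply/seteqP; split=> s /=.
    by move=> [[i ilt Vi]|Vn]; [exists i => //; exact: ltnW|exists n].
  move=> [i]; rewrite ltnS leq_eqVlt => /predU1P[-> |ilt Vi]; first by right.
  by left; exists i.
rewrite -subset0 => s [[i ilt Vi] Vn].
by move: ilt; rewrite (tV _ _ _ Vi Vn) ltnn.
Qed.

End theory.

(** The value at [E] is the limit of [nu_ n E], a sequence in the compact unit
    interval, along one ultrafilter for all [E]. As this is a single ultrafilter,
    sets of positive limit value are charged simultaneously by some [nu_ n]. *)
Lemma fin_add_ultralimit (nu_ : nat -> set S -> R) : (forall n, fin_add (nu_ n)) ->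
  exists nu, [/\ fin_add nu,
    forall E (e : R), nu_ n E @[n --> \oo] --> e -> nu E = e &
    forall E F, (0 < nu E)%R -> (0 < nu F)%R ->
      exists n, (0 < nu_ n E)%R /\ (0 < nu_ n F)%R].
Proof.
move=> hnu.
have [G [UG ooG]] := ultraFilterLemma (@eventually_filter).
have PG : ProperFilter G by exact: ultra_proper.
have lim_ex E : exists e : R, nu_ n E @[n --> G] --> e.
  have fG : (nu_ ^~ E @ G) `[0%R, 1%R]%classic.
    apply: (@filterE _ G) => n /=; rewrite in_itv/=; have [h0 h1 _] := hnu n.
    by rewrite h0 -h1 fin_add_le.
  have [e [_ ce]] := @segment_compact R 0%R 1%R (nu_ ^~ E @ G) _ fG.
  exists e => A Ae.
  have [//|GnA] := in_ultra_setVsetC ((nu_ ^~ E) @^-1` A) UG.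
  by have [t []] := ce (~` A) A GnA Ae.
have [nu nuP] := choice lim_ex.
have uniq E (e : R) : nu_ n E @[n --> G] --> e -> nu E = e.
  by move=> h; exact: (cvg_unique _ (nuP E) h).
exists nu; split.
- split.
  + move=> E; apply: (cvgr_to_ge (nuP E)); apply: filterE => n.
    by have [h0 _ _] := hnu n.
  + apply: uniq; rewrite (_ : (fun _ => _) = cst 1%R); first exact: cvg_cst.
    by apply/funext => n; have [_ ->] := hnu n.
  + move=> E F EF; apply: uniq; rewrite (_ : (fun _ => _) = (nu_ ^~ E \+ nu_ ^~ F)%R).
      exact: cvgD (nuP E) (nuP F).
    by apply/funext => n /=; have [_ _ ->] := hnu n.
- by move=> E e h; apply: uniq; apply: cvg_trans h; exact: cvg_app.
- move=> E F E0 F0.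
  have h1 : \forall n \near G, (0 < nu_ n E)%R by exact: (cvgr_gt _ (nuP E)).
  have h2 : \forall n \near G, (0 < nu_ n F)%R by exact: (cvgr_gt _ (nuP F)).
  by have [n [? ?]] := filter_ex (filterI h1 h2); exists n.
Qed.

End finitely_additive.

Section empirical.
Context (R : realType) (S : choiceType).

Definition empirical (z : seq S) (E : set S) : R :=
  ((count (fun s => s \in E) z)%:R / (size z)%:R)%R.

Lemma empirical_fin_add z : (0 < size z)%N -> fin_add (empirical z).
Proof.
move=> z0; split.
- by move=> E; rewrite divr_ge0.
- rewrite /empirical (eq_count (a2 := predT)); last by move=> s; rewrite /= in_setT.
  by rewrite count_predT divff// pnatr_eq0 -lt0n.
- move=> E F EF; rewrite /empirical -mulrDl -natrD -count_predUI.
  have -> : count (predI (fun s => s \in E) (fun s => s \in F)) z = 0%N.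
    apply/eqP; rewrite -leqn0 leqNgt -has_count; apply/hasPn => s _ /=.
    by rewrite -in_setI EF in_set0.
  by rewrite addn0; congr (_%:R / _)%R; apply: eq_count => s; rewrite /= in_setU.
Qed.

Lemma empirical_gt0 z E : (0 < empirical z E)%R -> exists2 s, s \in z & E s.
Proof.
move=> h; have : (0 < count (fun s => s \in E) z)%N.
  by rewrite lt0n; apply/eqP => c0; move: h; rewrite /empirical c0 mul0r ltxx.
by rewrite -has_count => /hasP[s sz]; rewrite inE; exists s.
Qed.

End empirical.
(** * Random words with prescribed cell probabilities *)

Section random_word.
Context (R : realType) (S : Type) (nu : set S -> R) (hnu : fin_add nu).
Variable c : nat -> S -> nat.

(** Words are written with their last letter first, so that extending a word is
    consing a letter. *)
Fixpoint cell (w : seq nat) : set S :=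
  if w is i :: v then cell v `&` [set s | c (size v) s = i] else setT.

Let q w := nu (cell w).
Let qc v (j : nat) := q (j :: v).

(** The intervals [slot (i :: v)], for [i = 0, 1, ...], are laid end to end from
    the left end of [slot v]. *)
Fixpoint left_end (w : seq nat) : R :=
  (if w is i :: v then left_end v + \sum_(j < i) qc v j else 0)%R.

Let slot (w : seq nat) : set R := `[left_end w, (left_end w + q w)%R[.

(* Tightness excludes that the mass of a cell escapes through larger and larger
   letters, that is, that the subintervals fail to fill their parent. *)
Hypothesis tight : forall k (e : R), (0 < e)%R ->
  exists N, (nu [set s | (N <= c k s)%N] < e)%R.

Let sum_children v n :
  (\sum_(j < n) qc v j = nu (cell v `&` [set s | (c (size v) s < n)%N]))%R.
Proof.
rewrite (fin_add_sum hnu (V := fun j => cell (j :: v))).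
  congr nu; apply/seteqP; split=> s /=.
    by move=> [i ilt [cv ->]].
  by move=> [cv clt]; exists (c (size v) s).
by move=> i j s /= [_ <-] [_ <-].
Qed.

Let sum_children_le v n : (\sum_(j < n) qc v j <= q v)%R.
Proof. by rewrite sum_children; apply: fin_add_le => // s []. Qed.

Let sum_children_gt v r : (r < q v)%R -> exists n, (r < \sum_(j < n) qc v j)%R.
Proof.
rewrite -subr_gt0 => /(tight (size v))[N hN]; exists N.
have [_ _ hD] := hnu.
rewrite sum_children -(ltrD2r (q v - r)%R) subrKC.
suff : (q v <= nu (cell v `&` [set s | (c (size v) s < N)%N]) +
    nu [set s | (N <= c (size v) s)%N])%R.
  by move=> /le_lt_trans; apply; rewrite ltrD2l.
rewrite -hD; last first.
  by rewrite -subset0 => s /= [[_ h1] h2]; move: h1; rewrite ltnNge h2.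
apply: fin_add_le => // s cs /=.
by have [|] := leqP N (c (size v) s); [right|left].
Qed.

Let slot_child v x : slot v x -> exists i, slot (i :: v) x.
Proof.
rewrite /slot /= in_itv/= => /andP[lx xr].
have [n0 hn0] : exists n, (x - left_end v < \sum_(j < n) qc v j)%R.
  by apply: sum_children_gt; rewrite ltrBlDl.
have ex : exists n, (x - left_end v < \sum_(j < n) qc v j)%R by exists n0.
have [n hn nmin] := ex_minnP ex.
case: n hn nmin => [|i] hn nmin.
  by move: hn; rewrite big_ord0 ltNge subr_ge0 lx.
exists i; rewrite in_itv/=; apply/andP; split.
  rewrite -lerBrDl leNgt; apply/negP => /nmin.
  by rewrite ltnn.
by move: hn; rewrite big_ord_recr/= ltrBlDl addrA.
Qed.

Let q_ge0 w : (0 <= q w)%R. Proof. by have [h _ _] := hnu; exact: h. Qed.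

Let slot_parent i v x : slot (i :: v) x -> slot v x.
Proof.
rewrite /slot /= !in_itv/= => /andP[lx xr]; apply/andP; split.
  by apply: le_trans lx; rewrite lerDl sumr_ge0// => ? _; exact: q_ge0.
apply: (lt_le_trans xr); rewrite -addrA lerD2l.
by have := sum_children_le v i.+1; rewrite big_ord_recr.
Qed.

Let slot_child_uniq i j v x : slot (i :: v) x -> slot (j :: v) x -> i = j.
Proof.
wlog : i j / (i <= j)%N.
  move=> h si sj; have [/h|/ltnW /h] := leqP i j; first exact.
  by move=> /(_ sj si) ->.
rewrite leq_eqVlt => /predU1P[//|ij]; rewrite /slot /= !in_itv/=.
move=> /andP[_ xi] /andP[xj _]; exfalso.
move: (le_lt_trans xj xi); rewrite -addrA ltrD2l ltNge => /negP; apply.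
rewrite -[leLHS](big_ord_recr i (qc v)) /=.
rewrite -(big_mkord xpredT (qc v)) -(big_mkord xpredT (qc v)).
by rewrite (big_cat_nat (n := i.+1) (p := j))//= lerDl sumr_ge0// => ? _; exact: q_ge0.
Qed.

Let wd (x : R) := fix wd k : seq nat :=
  if k is l.+1 then xget 0%N [set i | slot (i :: wd l) x] :: wd l else [::].

Let size_wd x k : size (wd x k) = k.
Proof. by elim: k => //= k ->. Qed.

Let slot_wd x k : (0 <= x < 1)%R -> slot (wd x k) x.
Proof.
move=> x01; elim: k => [|k IH].
  by rewrite /slot/= in_itv/= add0r /q/=; have [_ -> _] := hnu.
have [i hi] := slot_child IH.
exact: (xgetPex 0%N (ex_intro (fun i => slot (i :: wd x k) x) i hi)).
Qed.

Let wd_slot x w : (0 <= x < 1)%R -> slot w x -> wd x (size w) = w.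
Proof.
move=> x01; elim: w => //= i w IH hi.
have sw := IH (slot_parent hi); rewrite sw; congr cons.
apply: (slot_child_uniq _ hi).
exact: (xgetPex 0%N (ex_intro (fun i => slot (i :: w) x) i hi)).
Qed.

Let slot01 w x : slot w x -> (0 <= x < 1)%R.
Proof.
elim: w => [|i w IH]; last by move=> /slot_parent.
by rewrite /slot/= in_itv/= add0r /q/=; have [_ -> _] := hnu.
Qed.

(** Every word [w] owns a subinterval of the unit interval, of length
    [nu (cell w)], which is tiled by the subintervals of the one-letter extensions
    of [w]; a uniform point spells the words whose subintervals contain it. Its
    cells are never null, since it lies in intervals of their lengths. *)
Lemma random_word : exists (U : probability (measurableTypeR R) R)
    (word : R -> nat -> seq nat),
  [/\ forall x k, exists i, word x k.+1 = i :: word x k,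
      forall x k, size (word x k) = k,
      forall x k, (0 < nu (cell (word x k)))%R &
      forall w, measurable ([set x | word x (size w) = w] : set (measurableTypeR R)) /\
        U [set x | word x (size w) = w] = (nu (cell w))%:E].
Proof.
pose D : set (measurableTypeR R) := `[0%R, 1%R[%classic.
have DE y : D y <-> (0 <= y < 1)%R by rewrite /D/= in_itv.
have mD : measurable D by exact: measurable_itv.
(* Points outside the unit interval, a null set, spell the word of 0. *)
pose clamp (x : R) : R := if (0 <= x < 1)%R then x else 0%R.
have clamp01 x : (0 <= clamp x < 1)%R.
  by rewrite /clamp; case: ifP => // _; rewrite lexx ltr01.
pose U0 : {measure set (measurableTypeR R) -> \bar R} := mrestr lebesgue_measure mD.
have U1 : U0 setT = 1.
  rewrite /U0/= /mrestr setTI /D lebesgue_measure_itv/= lte_fin ltr01.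
  by rewrite -EFinB subr0.
pose U := HB.pack_for (probability (measurableTypeR R) R)
   (Measure.sort U0) (Measure_isProbability.Build _ _ _ U0 U1).
exists U, (fun x k => wd (clamp x) k).
have wdE w x : (wd (clamp x) (size w) = w) <-> slot w (clamp x).
  split; last exact: wd_slot.
  by move=> <-; exact: slot_wd.
split => //.
- by move=> x k; eexists.
- move=> x k; have := slot_wd k (clamp01 x); rewrite /slot/= in_itv/= => /andP[h1 h2].
  by have := le_lt_trans h1 h2; rewrite ltrDl.
move=> w.
have mslot : measurable (slot w : set (measurableTypeR R)) by exact: measurable_itv.
have E : [set x | wd (clamp x) (size w) = w] =
    slot w `|` (~` D `&` [set x | slot w 0%R]).
  apply/seteqP; split=> x /=.
    rewrite wdE /clamp; case: ifP => [x01|x01 s0]; first by left.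
    by right; split => // /DE; rewrite x01.
  rewrite wdE; move=> [sx|[nD s0]].
    by rewrite /clamp (slot01 sx).
  by rewrite /clamp; case: ifP.
have mE : measurable ([set x | wd (clamp x) (size w) = w] : set (measurableTypeR R)).
  rewrite E; apply: measurableU => //; apply: measurableI; first exact: measurableC.
  have [s0|s0] := pselect (slot w 0%R).
    by rewrite (_ : [set _ | _] = setT)//; apply/seteqP; split.
  by rewrite (_ : [set _ | _] = set0)//; apply/seteqP; split.
split => //; rewrite /U/= /U0/= /mrestr.
rewrite (_ : _ `&` D = slot w).
  rewrite /slot lebesgue_measure_itv/= lte_fin ltrDl lt_neqAle eq_sym.
  rewrite q_ge0 andbT -EFinB addrAC subrr add0r.
  by rewrite /q; case: (eqVneq (nu (cell w)) 0%R) => [->|].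
apply/seteqP; split=> x; rewrite E.
  by move=> [[//|[nD]]].
move=> sx; split; first by left.
by apply: (DE x).2; exact: slot01 sx.
Qed.

End random_word.
(** * Random limit points *)

Section borel_order.
Context (R : realType) (T : polishType R).

(** A closed set is the intersection of its open neighbourhoods of radius
    [1 / (n + 1)], so the inequality passes to closed sets; taking complements
    reverses it, whence equality on open sets. *)
Lemma borel_probability_le_open (P P' : probability (borel T) R) :
  (forall A, open A -> P A <= P' A) ->
  forall A, measurable (A : set (borel T)) -> P A = P' A.
Proof.
move=> le_open.
have le_closed (F : set T) : closed F -> P F <= P' F.
  move=> cF; pose N n := [set t | exists2 t', F t' & (mdist t t' < n.+1%:R^-1)%R].
  have oN n : open (N n).
    rewrite openE => t [t' Ft' tt'].
    apply: (@filterS _ _ _ [set u | (mdist t' u < n.+1%:R^-1)%R]).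
      by move=> u ut'; exists t' => //; rewrite metric_sym.
    by apply: open_nbhs_nbhs; split; [exact: open_mball|rewrite /= metric_sym].
  have capN : \bigcap_n N n = F.
    apply/seteqP; split=> [t Nt|t Ft n _]; last first.
      by exists t => //; rewrite mdistxx invr_gt0.
    apply: contrapT => nFt.
    have [e e0 eF] := open_mdist (closed_openC cF) nFt.
    have [n ne] : exists n : nat, (n.+1%:R^-1 < e)%R.
      by have /ltr_add_invr[n] := e0; rewrite add0r; exists n.
    have [t' Ft' tt'] := Nt n I.
    exact: (eF _ (lt_trans tt' ne)).
  have mF : measurable (F : set (borel T)).
    by rewrite -[F]setCK; apply: measurableC; apply: open_borel; exact: closed_openC.
  have cvP' : (P' \o N) x @[x --> \oo] --> P' F.
    rewrite (_ : P' F = P' (\bigcap_n N n)); last by rewrite capN.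
    apply: nonincreasing_cvg_mu.
    - by rewrite (le_lt_trans (probability_le1 _ _)) ?ltry//; exact: open_borel.
    - by move=> n; exact: open_borel.
    - by rewrite capN.
    - move=> m n mn; apply/subsetPset => t [t' Ft' tt']; exists t' => //.
      by rewrite (lt_le_trans tt')// lef_pV2 ?posrE// ler_nat.
  apply: (cvge_to_ge cvP'); apply: nearW => n /=.
  apply: le_trans (le_open _ (oN n)); apply: le_measure; rewrite ?inE//.
    exact: open_borel.
  by rewrite -capN => t; exact.
move=> A mA.
apply: (@g_sigma_algebra_measure_unique _ R (borel T) open _ (fun=> setT) _ _ P P') => //.
- by move=> O oO; exact: open_borel.
- by move=> _; exact: openT.
- by apply/seteqP; split => // x _; exists 0%N.
- exact: openI.
- move=> O oO; apply/eqP; rewrite eq_le le_open//=.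
  have mO : measurable (O : set (borel T)) by exact: open_borel.
  have := le_closed _ (open_closedC oO).
  rewrite !probability_setC//.
  have := fin_num_measure P _ mO; have := fin_num_measure P' _ mO.
  move=> /fineK <- /fineK <-.
  by rewrite -!EFinB !lee_fin lerD2l lerN2.
- by move=> _; rewrite (le_lt_trans (probability_le1 _ _)) ?ltry.
Qed.

End borel_order.

Section limit_point.
Context (R : realType) (S : Type) (nu : set S -> R) (hnu : fin_add nu).
Variable c : nat -> S -> nat.
Variables (d : measure_display) (W : measurableType d) (U : probability W R).
Variable word : W -> nat -> seq nat.
Hypothesis wordS : forall x k, exists i, word x k.+1 = i :: word x k.
Hypothesis size_word : forall x k, size (word x k) = k.
Hypothesis word_gt0 : forall x k, (0 < nu (cell c (word x k)))%R.
Hypothesis word_law : forall w, measurable [set x | word x (size w) = w] /\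
  U [set x | word x (size w) = w] = (nu (cell c w))%:E.

Lemma cell_word x k l s : (k <= l)%N ->
  cell c (word x l) s -> cell c (word x k) s.
Proof.
move=> /subnK <-; elim: (l - k)%N => // n IH.
by rewrite addSn; have [i ->] := wordS x (n + k)%N => -[/IH].
Qed.

Variables (T : polishType R) (mu : probability (borel T) R).
Variables (f : S -> T) (a : nat -> T -> nat).
Hypothesis ca : forall k s s', c k s = c k s' -> a k (f s) = a k (f s').
Hypothesis mesh : forall k t t', a k t = a k t' -> (mdist t t' < k.+1%:R^-1)%R.
Hypothesis ma : forall k i, measurable ([set t | a k t = i] : set (borel T)).
Hypothesis amu : forall k i, (nu [set s | a k (f s) = i])%:E = mu [set t | a k t = i].

Lemma cell_label k w s s' : size w = k.+1 -> cell c w s -> cell c w s' ->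
  a k (f s) = a k (f s').
Proof. by case: w => //= i w [<-] [_ <-] [_ /esym]; exact: ca. Qed.

(** A test on finite words for the limit point to fall into [O]; it passes to
    extensions of the word, and forces the whole class of the label of [f s], for
    [s] in the cell, to lie in [O]. *)
Definition inside (O : set T) k (w : seq nat) := size w = k.+1 /\
  forall t s, cell c w s -> (mdist t (f s) <= k.+1%:R^-1)%R -> O t.

(** The words that pass the test have disjoint cells, contained together in
    the preimage of the label classes included in [O]. Finitely many of them meet
    finitely many labels only, on which [nu] and [mu] agree by [amu]; finite
    additivity of [nu] is therefore enough. *)
Lemma inside_le (O : set T) k : open O ->
  U (\bigcup_n (if @pickle_inv (seq nat) n is Some w then
       [set x | inside O k w /\ word x (size w) = w] else set0)) <= mu O.
Proof.
move=> oO; set V : nat -> set W := fun n => _.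
pose D n : set S := if @pickle_inv (seq nat) n is Some w then
  [set s | inside O k w /\ cell c w s] else set0.
have VE n : measurable (V n) /\ U (V n) = (nu (D n))%:E.
  rewrite /V /D; case: pickle_inv => [w|]; last by rewrite (fin_add0 hnu) measure0.
  have [iw|niw] := pselect (inside O k w).
    rewrite (_ : [set x | inside O k w /\ _] = [set x | word x (size w) = w]); last first.
      by apply/seteqP; split=> x /=; [case|].
    rewrite (_ : [set s | inside O k w /\ _] = cell c w); last first.
      by apply/seteqP; split=> x /=; [case|].
    exact: word_law.
  rewrite (_ : [set x | inside O k w /\ _] = set0); last first.
    by apply/seteqP; split=> x /=; [case|].
  rewrite (_ : [set s | inside O k w /\ _] = set0); last first.
    by apply/seteqP; split=> x /=; [case|].
  by rewrite (fin_add0 hnu) measure0.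
have mV n : measurable (V n) by have [] := VE n.
have pickle_inj m n w : @pickle_inv (seq nat) m = Some w ->
    @pickle_inv (seq nat) n = Some w -> m = n.
  move=> mw nw; have := @pickle_invK (seq nat) m; have := @pickle_invK (seq nat) n.
  by rewrite mw nw /= => -> ->.
have tV : trivIset setT V.
  move=> m n _ _ [x [Vm Vn]]; move: Vm Vn; rewrite /V.
  case Em : pickle_inv => [w|//]; case En : pickle_inv => [w'|//] [[sw _] xw] [[sw' _] xw'].
  by apply: (@pickle_inj _ _ w) => //; rewrite En -xw -xw' sw sw'.
have cell_inj w w' s : size w = size w' -> cell c w s -> cell c w' s -> w = w'.
  elim: w w' => [|i w IH] [|j w']//= [sw] [ws <-] [ws' <-].
  by rewrite (IH w')// sw.
rewrite (measure_semi_bigcup U mV tV); last exact: bigcup_measurable.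
apply: lime_le; first exact: is_cvg_nneseries.
apply: nearW => N; rewrite big_mkord.
rewrite (eq_bigr (fun n : 'I_N => (nu (D n))%:E)); last by move=> n _; exact: (VE n).2.
rewrite sumEFin (fin_add_sum hnu); last first.
  move=> m n s; rewrite /D.
  case Em : pickle_inv => [w|//]; case En : pickle_inv => [w'|//] [[sw _] ws] [[sw' _] ws'].
  by apply: (@pickle_inj _ _ w) => //; rewrite En (cell_inj _ _ _ _ ws ws')// sw sw'.
have [M hM] : exists M, forall n s, (n < N)%N -> D n s -> (a k (f s) < M)%N.
  elim: N => [|N [M hM]]; first by exists 0%N.
  have [[s0 Ds0]|nD] := pselect (exists s, D N s).
    exists (maxn M (a k (f s0)).+1) => n s; rewrite ltnS leq_eqVlt leq_max.
    move=> /predU1P[->|nN Dns]; last by rewrite (hM n s).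
    rewrite /D in Ds0 *; case: pickle_inv Ds0 => // w [[sw _] ws0] [_ ws].
    by rewrite (cell_label sw ws ws0) ltnSn orbT.
  exists M => n s; rewrite ltnS leq_eqVlt => /predU1P[-> Dns|]; last exact: hM.
  by exfalso; apply: nD; exists s.
pose A i : set T :=
  if `[< [set t | a k t = i] `<=` O >] then [set t | a k t = i] else set0.
pose AS i : set S :=
  if `[< [set t | a k t = i] `<=` O >] then [set s | a k (f s) = i] else set0.
apply: (@le_trans _ _ (\sum_(i < M) mu (A i))).
  rewrite (eq_bigr (fun i : 'I_M => (nu (AS i))%:E)); last first.
    by move=> i _; rewrite /A /AS; case: ifP => _; rewrite ?amu// measure0 (fin_add0 hnu).
  rewrite sumEFin lee_fin (fin_add_sum hnu); last first.
    by move=> i j s; rewrite /AS; case: ifP => // _ <-; case: ifP => // _ <-.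
  apply: fin_add_le => // s [n nN Dns]; exists (a k (f s)); first exact: hM Dns.
  rewrite /AS asboolT// => t /= tk.
  move: Dns; rewrite /D; case: pickle_inv => // w [[sw wO] ws].
  by apply: (wO t s) => //; exact/ltW/mesh.
have mA i : measurable (A i : set (borel T)) by rewrite /A; case: ifP.
have tA : trivIset setT A.
  move=> i j _ _ [t []]; rewrite /A.
  by case: ifP => // _ <-; case: ifP => // _ <-.
apply: (@le_trans _ _ (mu (\bigcup_i A i))).
  rewrite (measure_semi_bigcup mu mA tA); last exact: bigcup_measurable.
  by rewrite -(big_mkord xpredT (fun i => mu (A i))); exact: nneseries_lim_ge.
apply: le_measure; rewrite ?inE; [exact: bigcup_measurable|exact: open_borel|].
by move=> t [i _]; rewrite /A; case: asboolP => // h; exact: h.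
Qed.

(** Any choice of points in the nested cells [cell c (word x k)] has a Cauchy
    image in [T], by [mesh]. Its limit lies in an open set [O] exactly if some
    prefix of the word is [inside O], which gives both measurability and, by
    [inside_le], a law dominated by [mu] on open sets, hence equal to [mu]. *)
Lemma limit_point : exists zeta : W -> T,
  [/\ measurable_fun setT (zeta : W -> borel T),
      forall A, measurable (A : set (borel T)) -> U (zeta @^-1` A) = mu A &
      forall x k s, cell c (word x k.+1) s -> (mdist (zeta x) (f s) <= k.+1%:R^-1)%R].
Proof.
have cell_ex x k : exists s, cell c (word x k) s.
  have := word_gt0 x k; apply: contraPP => /forallNP ne.
  rewrite (_ : cell _ _ = set0) ?(fin_add0 hnu) ?ltxx//.
  by apply/seteqP; split => // s /ne.
have close x k s s' : cell c (word x k.+1) s -> cell c (word x k.+1) s' ->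
    (mdist (f s) (f s') < k.+1%:R^-1)%R.
  by move=> h h'; apply: mesh; apply: cell_label h h'; rewrite size_word.
have zeta_ex x : exists z : T, forall k s, cell c (word x k.+1) s ->
    (mdist z (f s) <= k.+1%:R^-1)%R.
  have [g gP] := choice (cell_ex x).
  have gc k l : (k < l)%N -> cell c (word x k.+1) (g l).
    by move=> kl; apply: (cell_word kl); exact: gP.
  have cau : cvg (f (g l) @[l --> \oo]).
    apply: cauchy_cvg; apply: cauchy_exP => e e0.
    have [n ne] : exists n : nat, (n.+1%:R^-1 < e)%R.
      by have /ltr_add_invr[n] := e0; rewrite add0r; exists n.
    exists (f (g n.+1)); exists n.+1 => // l /= nl.
    rewrite ballEmdist/= (lt_trans _ ne)//.
    by apply: (@close x); exact: gc.
  exists (lim (f (g l) @[l --> \oo])) => k s ks.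
  rewrite leNgt; apply/negP => lt_s.
  set z := lim _ in lt_s.
  have e0 : (0 < mdist z (f s) - k.+1%:R^-1)%R by rewrite subr_gt0.
  have hz : f (g l) @[l --> \oo] --> z by [].
  have [n _ hn] : \forall l \near \oo, (mdist z (f (g l)) < mdist z (f s) - k.+1%:R^-1)%R.
    have nz : nbhs z [set y | (mdist z y < mdist z (f s) - k.+1%:R^-1)%R].
      by apply: open_nbhs_nbhs; split; [exact: open_mball|rewrite /= mdistxx].
    exact: (hz _ nz).
  pose l := maxn n k.+1.
  have h1 := hn l (leq_maxl _ _).
  have h2 := close _ _ _ _ (gc k l (leq_maxr _ _)) ks.
  have h3 := metric_triangle z (f (g l)) (f s).
  by have := le_lt_trans h3 (ltrD h1 h2); rewrite subrK ltxx.
have [zeta zetaP] := choice zeta_ex.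
have cover (O : set T) : open O -> forall x, O (zeta x) ->
    exists k, inside O k (word x k.+1).
  move=> oO x Ox; have [e e0 eO] := open_mdist oO Ox.
  have [n ne] : exists n : nat, (n.+1%:R^-1 < e / 2)%R.
    have : (0 < e / 2)%R by rewrite divr_gt0.
    by move=> /ltr_add_invr[n]; rewrite add0r; exists n.
  exists n; split; first by rewrite size_word.
  move=> t s ws ts; apply: eO.
  have := metric_triangle (zeta x) (f s) t; have := zetaP x n s ws.
  move: ts ne; rewrite (metric_sym (f s)); move: (n.+1%:R^-1)%R => r; lra.
have inside_O (O : set T) k x : inside O k (word x k.+1) -> O (zeta x).
  move=> [_ h]; have [s ws] := cell_ex x k.+1.
  by apply: (h _ s) => //; exact: zetaP.
pose V (O : set T) k n : set W := if @pickle_inv (seq nat) n is Some w then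
  [set x | inside O k w /\ word x (size w) = w] else set0.
have mV O k n : measurable (V O k n).
  rewrite /V; case: pickle_inv => // w.
  have [iw|niw] := pselect (inside O k w).
    rewrite (_ : [set x | inside O k w /\ _] = [set x | word x (size w) = w]).
      by have [] := word_law w.
    by apply/seteqP; split=> x /=; [case|].
  rewrite (_ : [set x | inside O k w /\ _] = set0)//.
  by apply/seteqP; split=> x /=; [case|].
have mVk O k : measurable (\bigcup_n V O k n) by exact: bigcup_measurable.
have VP O k x : (\bigcup_n V O k n) x <-> inside O k (word x k.+1).
  split=> [[n _]|h].
    rewrite /V; case: pickle_inv => // w [iw xw].
    by have [sw _] := iw; rewrite -sw xw.
  exists (pickle (word x k.+1)) => //; rewrite /V pickleK_inv; split => //.
  by rewrite size_word.
have zE (O : set T) : open O -> zeta @^-1` O = \bigcup_k \bigcup_n V O k n.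
  move=> oO; apply/seteqP; split=> x.
    by move=> /(cover _ oO)[k hk]; exists k => //; apply/VP.
  by move=> [k _ /VP]; exact: inside_O.
have mz : measurable_fun setT (zeta : W -> borel T).
  by apply: borel_measurable => O oO; rewrite zE//; exact: bigcup_measurable.
exists zeta; split => //.
have [P PE] := push_probability U mz.
suff h A : open A -> P A <= mu A.
  by move=> A mA; rewrite -PE; exact: borel_probability_le_open.
move=> oA; rewrite PE zE//.
have cv : (U \o (fun k => \bigcup_n V A k n)) x @[x --> \oo] -->
    U (\bigcup_k \bigcup_n V A k n).
  apply: nondecreasing_cvg_mu => //; first exact: bigcup_measurable.
  apply/nondecreasing_seqP => k; apply/subsetPset => x /VP[_ h]; apply/VP; split.
    by rewrite size_word.
  move=> t s ws ts; apply: (h t s); first exact: cell_word ws.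
  by apply: (le_trans ts); rewrite lef_pV2 ?posrE// ler_nat.
by apply: (cvge_to_le cv); apply: nearW => k /=; exact: inside_le.
Qed.

End limit_point.
(** * Couplings as limits of samples *)

(** The label of a point at level [k] is the first term of a dense sequence at
    distance less than [1 / (2 (k + 1))]. *)
Lemma polish_labels (R : realType) (T : polishType R) : exists a : nat -> T -> nat,
  (forall k i, measurable ([set t | a k t = i] : set (borel T))) /\
  (forall k t t', a k t = a k t' -> (mdist t t' < k.+1%:R^-1 :> R)%R).
Proof.
have [d dP] := dense_seq T.
pose h k : R := (k.+1%:R^-1 / 2)%R.
have h0 k : (0 < h k)%R by rewrite divr_gt0.
exists (fun k t => ex_minn (dP t (h k) (h0 k))); split=> [k i|k t t'].
  have mB j : measurable ([set t | (mdist t (d j) < h k)%R] : set (borel T)).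
    rewrite (_ : [set _ | _] = [set t | (mdist (d j) t < h k)%R]).
      by apply: open_borel; exact: open_mball.
    by apply/seteqP; split=> t /=; rewrite metric_sym.
  rewrite (_ : [set _ | _] = [set t | (mdist t (d i) < h k)%R] `&`
     \bigcap_j (if (j < i)%N then ~` [set t | (mdist t (d j) < h k)%R] else setT)).
    apply: measurableI => //; apply: bigcapT_measurable => j.
    by case: ifP => // _; exact: measurableC.
  apply/seteqP; split=> t /=.
    case: ex_minnP => m hm mmin <-; split => // j _; case: ifP => // jm /= /mmin.
    by rewrite leqNgt jm.
  move=> [hi hj]; case: ex_minnP => m hm mmin.
  apply/eqP; rewrite eqn_leq mmin//= leqNgt; apply/negP => mi.
  by have := hj m I; rewrite mi; apply.
case: ex_minnP => m hm _; case: ex_minnP => m' hm' _ /= e.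
rewrite -e in hm'.
have := metric_triangle t (d m) t'; rewrite (metric_sym (d m)).
move: hm hm'; rewrite /h; move: (k.+1%:R^-1)%R => r; lra.
Qed.

(** The classes of the labels below [N] carry the same mass for [nu] as for
    [mu], and for [mu] this mass tends to 1. *)
Lemma fin_add_tight (R : realType) (S : Type) (nu : set S -> R) (hnu : fin_add nu)
    d (T : measurableType d) (mu : probability T R) (f : S -> T) (a : T -> nat) :
  (forall i, measurable [set t | a t = i]) ->
  (forall i, (nu [set s | a (f s) = i])%:E = mu [set t | a t = i]) ->
  forall e : R, (0 < e)%R -> exists N, (nu [set s | (N <= a (f s))%N] < e)%R.
Proof.
move=> ma amu e e0; apply: contrapT => /forallNP nN.
have [_ nuT nuD] := hnu.
have bigA : \bigcup_i [set t | a t = i] = setT.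
  by apply/seteqP; split => // t _; exists (a t).
have tA : trivIset setT (fun i => [set t | a t = i]).
  by move=> i j _ _ [t [/= <- <-]].
have : mu setT <= (1 - e)%:E.
  rewrite -bigA (measure_semi_bigcup mu ma tA); last exact: bigcup_measurable.
  apply: lime_le; first exact: is_cvg_nneseries.
  apply: nearW => N; rewrite big_mkord.
  rewrite (eq_bigr (fun i : 'I_N => (nu [set s | a (f s) = i])%:E)); last first.
    by move=> i _; rewrite amu.
  rewrite sumEFin lee_fin (fin_add_sum hnu (V := fun i => [set s | a (f s) = i])).
    rewrite lerBrDr -nuT; have /negP := nN N; rewrite -leNgt => /(lerD (lexx _)) h.
    apply: (le_trans (h _)); rewrite -nuD; first exact: fin_add_le.
    by rewrite -subset0 => s /= [[i iN ai] Ns]; move: iN; rewrite -ai ltnNge Ns.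
  by move=> i j s /= <- <-.
rewrite [leLHS]probability_setT lee_fin; lra.
Qed.

(** An ultralimit of the empirical measures is a finitely additive probability
    on pairs, whose marginals are right on all label classes. The two limit points
    read off from its random words are coupled random variables of laws [mu] and
    [mu']. An open set charged by their joint law contains a cell charged by the
    ultralimit, and two such cells are visited by one and the same sample. *)
Lemma coupling_of_samples (R : realType) (X Y : polishType R)
    (mu : probability (borel X) R) (mu' : probability (borel Y) R)
    (a : nat -> X -> nat) (b : nat -> Y -> nat)
    (ma : forall k i, measurable ([set t | a k t = i] : set (borel X)))
    (mb : forall k i, measurable ([set t | b k t = i] : set (borel Y)))
    (mesha : forall k t t', a k t = a k t' -> (mdist t t' < k.+1%:R^-1 :> R)%R)
    (meshb : forall k t t', b k t = b k t' -> (mdist t t' < k.+1%:R^-1 :> R)%R)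
    (z : nat -> seq (X * Y)%type) :
  (forall n, (0 < size (z n))%N) ->
  (forall k i, empirical R (z n) [set s | a k s.1 = i] @[n --> \oo] -->
     fine (mu [set t | a k t = i])) ->
  (forall k i, empirical R (z n) [set s | b k s.2 = i] @[n --> \oo] -->
     fine (mu' [set t | b k t = i])) ->
  exists2 P, couplings mu mu' P &
    forall s s', @supp R (X * Y)%type P s -> @supp R (X * Y)%type P s' ->
    forall O O', open O -> open O' -> O s -> O' s' ->
    exists n u u', [/\ u \in z n, u' \in z n, O u & O' u'].
Proof.
move=> z0 cva cvb.
have [nu [hnu nulim nupos]] := fin_add_ultralimit (fun n => empirical_fin_add R (z0 n)).
have amu k i : (nu [set s | a k s.1 = i])%:E = mu [set t | a k t = i].
  by rewrite (nulim _ _ (cva k i)) fineK//; exact: fin_num_measure.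
have bmu k i : (nu [set s | b k s.2 = i])%:E = mu' [set t | b k t = i].
  by rewrite (nulim _ _ (cvb k i)) fineK//; exact: fin_num_measure.
pose c k (s : X * Y) : nat := pickle (a k s.1, b k s.2).
have tight k (e : R) : (0 < e)%R -> exists N, (nu [set s | (N <= c k s)%N] < e)%R.
  move=> e0; have e2 : (0 < e / 2)%R by rewrite divr_gt0.
  have [M hM] := @fin_add_tight R (X * Y)%type nu hnu _ (borel X) mu fst
    (a k) (ma k) (amu k) _ e2.
  have [M' hM'] := @fin_add_tight R (X * Y)%type nu hnu _ (borel Y) mu' snd
    (b k) (mb k) (bmu k) _ e2.
  (* The sum exceeds every code of a pair of labels below M and M'. *)
  exists (\sum_(i < M) \sum_(j < M') (pickle (i : nat, j : nat)).+1)%N.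
  pose A := [set s : X * Y | (M <= a k s.1)%N].
  pose A' := [set s : X * Y | (M' <= b k s.2)%N].
  have [_ _ hD] := hnu.
  apply: (@le_lt_trans _ _ (nu A + nu A')%R); last by rewrite (splitr e) ltrD.
  apply: (@le_trans _ _ (nu A + nu (A' `\` A))%R); last first.
    by rewrite lerD2l; apply: fin_add_le => // s [].
  rewrite -hD; last by rewrite setDE setICA setICr setI0.
  apply: fin_add_le => // s /= hs.
  have [Ms|sM] := leqP M (a k s.1); first by left.
  have [Ms'|sM'] := leqP M' (b k s.2).
    by right; split => // As; move: sM; rewrite ltnNge As.
  exfalso; move: hs; rewrite leqNgt => /negP; apply.
  rewrite (bigD1 (Ordinal sM))//= (bigD1 (Ordinal sM'))//= /c -addnA.
  exact: leq_addr.
have [U [word [wordS size_word word_gt0 word_law]]] := random_word hnu tight.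
have ca k (s s' : X * Y) : c k s = c k s' -> a k s.1 = a k s'.1.
  by move=> /(pcan_inj pickleK)[].
have cb k (s s' : X * Y) : c k s = c k s' -> b k s.2 = b k s'.2.
  by move=> /(pcan_inj pickleK)[].
have [zX [mzX zXmu zXP]] :=
  limit_point (U := U) hnu wordS size_word word_gt0 word_law ca mesha ma amu.
have [zY [mzY zYmu zYP]] :=
  limit_point (U := U) hnu wordS size_word word_gt0 word_law cb meshb mb bmu.
have [bX hX] := polish_basis X; have [bY hY] := polish_basis Y.
have [P PE] := push_probability U (borel_measurable_pair hX hY mzX mzY).
exists P; first by split=> A mA; rewrite PE; [exact: zXmu|exact: zYmu].
have cellO O s : open O -> O s -> @supp R (X * Y)%type P s ->
    exists2 w, cell c w `<=` O & (0 < nu (cell c w))%R.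
  move=> oO Os hs; have := hs O oO Os.
  rewrite PE lt_neqAle => /andP[/eqP PO _]; apply: contrapT => /forall2NP nw.
  apply/PO/esym.
  pose V n : set (measurableTypeR R) := if @unpickle (seq nat) n is Some w then
    (if `[< cell c w `<=` O >] then [set x | word x (size w) = w] else set0) else set0.
  have mV n : measurable (V n).
    rewrite /V; case: unpickle => // w; case: ifP => // _.
    by have [] := word_law w.
  have UV : U (\bigcup_n V n) = 0.
    apply/negligibleP; first exact: bigcup_measurable.
    apply: negligible_bigcup => n; apply/negligibleP => //.
    rewrite /V; case: unpickle => [w|]; last exact: measure0.
    case: asboolP => [wO|_]; last exact: measure0.
    apply: (etrans (word_law w).2); congr EFin; apply/eqP.
    have [//|/negP] := nw w; rewrite -leNgt => le0.
    by rewrite eq_le le0; have [h _ _] := hnu; exact: h.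
  apply/eqP; rewrite eq_le measure_ge0 andbT -UV; apply: le_measure; rewrite ?inE.
  - exact: (borel_preimage (borel_measurable_pair hX hY mzX mzY) oO).
  - exact: bigcup_measurable.
  move=> x Ox.
  have : nbhs (zX x, zY x) O by apply: open_nbhs_nbhs.
  move=> [[B1 B2] /= [B1x B2y] BO].
  move: B1x; rewrite -nbhs_ballE => -[e1 /= e10 eB1].
  move: B2y; rewrite -nbhs_ballE => -[e2 /= e20 eB2].
  have [n] : exists n : nat, (n.+1%:R^-1 < Num.min e1 e2)%R.
    have : (0 < Num.min e1 e2)%R by rewrite lt_min e10.
    by move=> /ltr_add_invr[n]; rewrite add0r; exists n.
  rewrite lt_min => /andP[ne1 ne2].
  exists (pickle (word x n.+1)) => //; rewrite /V pickleK size_word asboolT//.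
  move=> [u v] uv; apply: BO; split=> /=.
    by apply: eB1; rewrite ballEmdist/=; exact: le_lt_trans (zXP x n _ uv) ne1.
  by apply: eB2; rewrite ballEmdist/=; exact: le_lt_trans (zYP x n _ uv) ne2.
move=> s s' hs hs' O O' oO oO' Os Os'.
have [w wO w0] := cellO _ _ oO Os hs; have [w' wO' w0'] := cellO _ _ oO' Os' hs'.
have [n [/empirical_gt0[u uz uw] /empirical_gt0[u' uz' uw']]] := nupos _ _ w0 w0'.
by exists n, u, u'; split => //; [exact: wO|exact: wO'].
Qed.
(** * The weak law of large numbers *)

Section weak_law.
Context (I : countType) d (T : measurableType d) (R : realType) (m : probability T R).
Variables (A : set T) (mA : measurable A) (s : seq I) (us : uniq s).
Local Notation P := (product_measure I m).
Local Notation n := ((size s)%:R : R).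
Local Notation p := (fine (m A)).
Local Notation CT := (g_sigma_algebraType (@coordinate_cylinders I _ T)).

Let N (x : I -> T) : R := (\sum_(i <- s) \1_A (x i))%R.

Let mcoord i : measurable ([set x | A (x i)] : set CT).
Proof. by apply: sub_sigma_algebra; exists i, A. Qed.

Let p0 : (0 <= p)%R. Proof. exact: fine_ge0. Qed.

Let mAE : m A = p%:E. Proof. by rewrite fineK//; exact: fin_num_measure. Qed.

Let p1 : (p <= 1)%R. Proof. by rewrite -lee_fin -mAE; exact: probability_le1. Qed.

Let coord1 i : \int[P]_x (\1_A (x i))%:E = p%:E.
Proof.
rewrite (_ : (fun _ => _) = (fun x => (\1_([set x | A (x i)] : set CT) x)%:E)).
  rewrite integral_indic// setIT.
  have := @product_measureE I _ T R m [:: i] (fun=> A) isT (fun=> mA).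
  rewrite big_seq1 mAE => <-; congr (product_measure _ _ _).
  by apply/seteqP; split=> x /=; [move=> h j; rewrite inE => /eqP->|apply; rewrite mem_head].
by apply/funext => x; rewrite !indicE; congr (_%:R%:E); apply/idP/idP; rewrite !inE.
Qed.

Let coord2 i j : \int[P]_x (\1_A (x i) * \1_A (x j))%:E <= ((i == j)%:R * p + p * p)%:E.
Proof.
have [<-|ij] := eqVneq i j.
  rewrite (_ : (fun _ => _) = (fun x => (\1_A (x i))%:E)).
    by rewrite coord1 mul1r lee_fin lerDl mulr_ge0.
  by apply/funext => x; rewrite indicE; case: (_ \in _); rewrite ?mulr1 ?mulr0.
rewrite (_ : (fun _ => _) = (fun x =>
    (\1_([set x | A (x i)] `&` [set x | A (x j)] : set CT) x)%:E)).
  rewrite integral_indic//; last exact: measurableI.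
  rewrite setIT mul0r add0r EFinM -mAE.
  have := @product_measureE I _ T R m [:: i; j] (fun=> A) _ (fun=> mA).
  rewrite /= inE ij => /(_ isT); rewrite big_cons big_seq1 => <-.
  rewrite le_eqVlt; apply/orP; left; apply/eqP; congr (product_measure _ _ _).
  apply/seteqP; split=> x /=.
    by move=> [Ai Aj] k; rewrite !inE => /orP[/eqP->|/eqP->].
  by move=> h; split; apply: h; rewrite !inE eqxx ?orbT.
apply/funext => x; rewrite indicI /= !indicE.
by congr ((_%:R * _%:R)%:E); apply/idP/idP; rewrite !inE.
Qed.

Let mterm i : measurable_fun setT ((fun x => \1_A (x i)) : CT -> R).
Proof.
have := measurableT_comp (measurable_indic mA) (@measurable_coordinate I _ T i).
exact.
Qed.

Let mN : measurable_fun setT (N : CT -> R).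
Proof. by apply: measurable_sum => i; exact: mterm. Qed.

Let intN : \int[P]_x (N x)%:E = (n * p)%:E.
Proof.
under eq_integral do rewrite /N -sumEFin.
rewrite ge0_integral_sum//; last by move=> i; exact/measurable_EFinP.
rewrite (eq_bigr (fun=> p%:E)); last by move=> i _; exact: coord1.
by rewrite sumEFin big_const_seq count_predT iter_addr_0 mulr_natl.
Qed.

Let intN2 : \int[P]_x (N x * N x)%:E <= (n * p + n * n * (p * p))%:E.
Proof.
rewrite (_ : (fun _ => _) = (fun x =>
    \sum_(i <- s) \sum_(j <- s) (\1_A (x i) * \1_A (x j))%:E)); last first.
  apply/funext => x; rewrite /N big_distrl/= -sumEFin; apply: eq_bigr => i _.
  by rewrite big_distrr/= -sumEFin.
have mij i j : measurable_fun setT ((fun x => (\1_A (x i) * \1_A (x j))%:E) : CT -> \bar R).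
  by apply/measurable_EFinP; exact: measurable_funM.
rewrite ge0_integral_sum//; last 2 first.
- by move=> i; apply: emeasurable_sum => j; exact: mij.
- by move=> i x _; apply: sume_ge0 => j _; rewrite lee_fin mulr_ge0.
apply: (@le_trans _ _ (\sum_(i <- s) \sum_(j <- s) ((i == j)%:R * p + p * p)%:E)).
  apply: lee_sum => i _; rewrite ge0_integral_sum//.
  by apply: lee_sum => j _; exact: coord2.
rewrite le_eqVlt; apply/orP; left; apply/eqP.
under eq_bigr do rewrite sumEFin.
rewrite sumEFin; congr EFin.
rewrite (eq_big_seq (fun=> p + n * (p * p))%R); last first.
  move=> i si; rewrite big_split/= -mulr_suml; congr (_ + _)%R.
    rewrite (bigD1_seq i)//= eqxx big1 ?addr0 ?mul1r// => j ji.
    by rewrite eq_sym (negbTE ji).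
  by rewrite big_const_seq count_predT iter_addr_0 mulr_natl.
by rewrite big_const_seq count_predT iter_addr_0 -[LHS]mulr_natl mulrDr mulrA.
Qed.

Let intVar : \int[P]_x ((N x - n * p) ^+ 2)%:E <= n%:E.
Proof.
have np0 : (0 <= n * p)%R by rewrite mulr_ge0.
have mV : measurable_fun setT (fun x : CT => ((N x - n * p) ^+ 2)%:E).
  by apply/measurable_EFinP; apply: measurable_funX; exact: measurable_funB.
have mN1 : measurable_fun setT (fun x : CT => (N x)%:E) by exact/measurable_EFinP.
have N0 x : (0 <= N x)%R by apply: sumr_ge0.
have PT : (P : {measure set CT -> \bar R}) setT = 1 by exact: probability_setT.
(* The square is expanded with all terms on the side where they are
   nonnegative, so that the integral is additive without integrability. *)
have E : \int[P]_x ((N x - n * p) ^+ 2)%:E + (2 * (n * p))%:E * (n * p)%:E =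
    \int[P]_x (N x * N x)%:E + ((n * p) ^+ 2)%:E.
  rewrite -intN -ge0_integralZl//; last first.
  - by rewrite lee_fin mulr_ge0.
  - by move=> x _; rewrite lee_fin.
  rewrite -ge0_integralD//; last 3 first.
  - by move=> x _; rewrite lee_fin sqr_ge0.
  - by move=> x _; rewrite -EFinM lee_fin !mulr_ge0.
  - exact: measurable_funeM.
  have -> : ((n * p) ^+ 2)%:E = \int[P]_x (cst ((n * p) ^+ 2)%:E x).
    by rewrite integral_cst// [X in _ * X]PT mule1.
  rewrite -ge0_integralD//; last 3 first.
  - by move=> x _; rewrite lee_fin mulr_ge0.
  - by apply/measurable_EFinP; exact: measurable_funM.
  - by move=> x _; rewrite lee_fin sqr_ge0.
  apply: eq_integral => x _; rewrite -EFinM -!EFinD; congr EFin; ring.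
have : \int[P]_x ((N x - n * p) ^+ 2)%:E + (2 * (n * p))%:E * (n * p)%:E <=
    (n * p + n * n * (p * p))%:E + ((n * p) ^+ 2)%:E.
  by rewrite E leeD2r ?intN2.
rewrite -EFinM -leeBrDr// => /le_trans; apply; rewrite -!EFinD lee_fin.
rewrite (_ : _ - _ = n * p)%R; last by ring.
by rewrite -[leRHS]mulr1 ler_wpM2l.
Qed.

(** Chebyshev's inequality for the number [N] of indices in [s] with [x i] in
    [A], whose variance is at most the size of [s]. *)
Lemma weak_law (e : R) : (0 < e)%R -> (0 < size s)%N ->
  measurable ([set x | (e <= `| (count (fun i => x i \in A) s)%:R / n - p |)%R] : set CT) /\
  P [set x | (e <= `| (count (fun i => x i \in A) s)%:R / n - p |)%R] <=
    ((e ^+ 2 * n)^-1)%:E.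
Proof.
move=> e0 s0; have n0 : (0 < n)%R by rewrite ltr0n.
have NE x : (count (fun i => x i \in A) s)%:R = N x.
  rewrite /N -sum1_count natr_sum big_mkcond/=; apply: eq_bigr => i _.
  by rewrite indicE; case: (_ \in _).
have mV : measurable_fun setT (fun x : CT => ((N x - n * p) ^+ 2)%:E).
  by apply/measurable_EFinP; apply: measurable_funX; exact: measurable_funB.
have key x : (e <= `|N x / n - p|)%R = ((e * n) ^+ 2 <= (N x - n * p) ^+ 2)%R.
  have -> : (N x / n - p = (N x - n * p) / n)%R by field; rewrite gt_eqF.
  rewrite normf_div (gtr0_norm n0) ler_pdivlMr//.
  by rewrite -ler_sqr ?nnegrE ?mulr_ge0 ?(ltW e0)// real_normK ?num_real.
have absV x : `|((N x - n * p) ^+ 2)%:E| = ((N x - n * p) ^+ 2)%:E.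
  by rewrite gee0_abs// lee_fin sqr_ge0.
have E : [set x | (e <= `| (count (fun i => x i \in A) s)%:R / n - p |)%R] =
    setT `&` [set x : CT | ((e * n) ^+ 2)%:E <= `|((N x - n * p) ^+ 2)%:E|].
  by rewrite setTI; apply/seteqP; split=> x; rewrite /mkset absV lee_fin -key NE.
have en0 : (0 < (e * n) ^+ 2)%R by rewrite exprn_gt0// mulr_gt0.
split.
  rewrite E; apply: (@emeasurable_fun_c_infty _ _ _ setT) => //.
  exact: measurableT_comp.
rewrite E; have := le_integral_abse P measurableT mV en0.
under [X in _ <= X -> _]eq_integral do rewrite absV.
move=> /le_trans /(_ intVar); rewrite -lee_pdivlMl//.
move=> /le_trans; apply; rewrite -EFinM lee_fin.
rewrite le_eqVlt; apply/orP; left; apply/eqP.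
by field; rewrite !gt_eqF.
Qed.

End weak_law.
(** * Large samples see the Gromov-Wasserstein distance *)

Section large_samples.
Context (R : realType).

Lemma mdist_close (T : polishType R) (s s' u u' : T) :
  (`|mdist s s' - mdist u u'| <= mdist s u + mdist s' u' :> R)%R.
Proof.
have h1 := metric_triangle s u s'; have h2 := metric_triangle u u' s'.
have h3 := metric_triangle u s u'; have h4 := metric_triangle s s' u'.
move: h1 h2 h3 h4; rewrite (metric_sym u' s') (metric_sym u s) => h1 h2 h3 h4.
rewrite ler_norml; apply/andP; split; lra.
Qed.

(** Only the first [N] labels of the first [N] levels are tested: these are
    finitely many events, so the weak law of large numbers applies to them
    uniformly, and as [N] grows they exhaust all labels. *)
Definition representative (T : choiceType) (m : set T -> \bar R)
    (a : nat -> T -> nat) (N : nat) (z : seq T) :=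
  forall k i, (k < N)%N -> (i < N)%N ->
    (`|empirical R z [set t | a k t = i] - fine (m [set t | a k t = i])| < N.+1%:R^-1)%R.

Lemma representative_cvg (T S : choiceType) (m : set T -> \bar R)
    (a : nat -> T -> nat) (f : S -> T) (z : nat -> seq S) :
  (forall n, representative m a n (map f (z n))) ->
  forall k i, empirical R (z n) [set s | a k (f s) = i] @[n --> \oo] -->
    fine (m [set t | a k t = i]).
Proof.
move=> rep k i; apply/cvgrPdist_lt => e e0.
have [n0 ne] : exists n : nat, (n.+1%:R^-1 < e)%R.
  by have /ltr_add_invr[n] := e0; rewrite add0r; exists n.
exists (maxn n0 (maxn k i).+1) => // n /=.
rewrite geq_max gtn_max => /and3P[n0n kn iN].
have := rep n k i kn iN; rewrite distrC /empirical size_map count_map.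
rewrite (eq_count (a2 := fun s => s \in [set s | a k (f s) = i])); last first.
  by move=> s /=; apply/idP/idP; rewrite !inE.
move=> /lt_trans; apply; apply: le_lt_trans ne.
by rewrite lef_pV2 ?posrE// ler_nat.
Qed.

Context (B : polishType R) (X Y : mmField B).
Variables (aX : nat -> X -> nat) (aY : nat -> Y -> nat).
Hypothesis maX : forall k i, measurable ([set t | aX k t = i] : set (borel X)).
Hypothesis maY : forall k i, measurable ([set t | aY k t = i] : set (borel Y)).
Hypothesis meshX : forall k t t', aX k t = aX k t' -> (mdist t t' < k.+1%:R^-1 :> R)%R.
Hypothesis meshY : forall k t t', aY k t = aY k t' -> (mdist t t' < k.+1%:R^-1 :> R)%R.

(** Otherwise there would be, for every [N], a pairing of representative
    samples with smaller distortion. Any limit coupling has its support inside the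
    limits of the sampled pairs, so its cost would be at most [c]. *)
Lemma representative_pairing (c : R) : c%:E < dGWoo X Y ->
  exists N, forall z : seq (X * Y)%type, (0 < size z)%N ->
    representative (mm_measure X) aX N (map fst z) ->
    representative (mm_measure Y) aY N (map snd z) ->
    (exists u u', [/\ u \in z, u' \in z & (2 * c <= mXY (u, u'))%R]) \/
    (exists2 u, u \in z & (c <= dXY u)%R).
Proof.
move=> cGW; apply: contrapT => /forallNP nN.
have /choice[z zP] : forall N, exists z : seq (X * Y)%type, [/\ (0 < size z)%N,
    representative (mm_measure X) aX N (map fst z),
    representative (mm_measure Y) aY N (map snd z),
    forall u u', u \in z -> u' \in z -> (mXY (u, u') < 2 * c)%R &
    forall u, u \in z -> (dXY u < c)%R].
  move=> N; have /existsNP[z] := nN N.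
  move=> /not_implyP[z0 /not_implyP[rX /not_implyP[rY /not_orP[n1 n2]]]].
  exists z; split => //.
    move=> u u' uz u'z; rewrite ltNge; apply/negP => h; apply: n1.
    by exists u, u'.
  by move=> u uz; rewrite ltNge; apply/negP => h; apply: n2; exists u.
have [P PC Psupp] := coupling_of_samples maX maY meshX meshY
  (fun n => let: And5 h _ _ _ _ := zP n in h)
  (representative_cvg (fun n => let: And5 _ h _ _ _ := zP n in h))
  (representative_cvg (fun n => let: And5 _ _ h _ _ := zP n in h)).
have [bX hX] := polish_basis X; have [bY hY] := polish_basis Y.
have hZ := is_basis_prod hX hY.
move: cGW; rewrite ltNge => /negP; apply.
pose ball2 (s : X * Y) (e : R) : set (X * Y) :=
  [set x | (mdist s.1 x < e)%R] `*` [set y | (mdist s.2 y < e)%R].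
have oball s e : open (ball2 s e) by apply: openX; exact: open_mball.
have inball (s : X * Y) e : (0 < e)%R -> ball2 s e s by move=> e0; split; rewrite /= mdistxx.
apply: ge_ereal_inf; eexists; first by exists P => //; exact: PC.
rewrite ge_max; apply/andP; split.
  rewrite lee_pdivrMl//; apply: ge_ereal_sup => _ [[s s'] hs <-].
  have [hs1 hs2] := (supp_product hZ P s s').1 hs.
  rewrite -EFinM lee_fin leNgt; apply/negP => lt_m.
  pose e := ((mXY (s, s') - 2 * c) / 4)%R.
  have e0 : (0 < e)%R by rewrite divr_gt0// subr_gt0.
  have [n [u [u' [uz u'z [/= u1 u2] [/= u1' u2']]]]] :=
    Psupp s s' hs1 hs2 _ _ (oball s e) (oball s' e) (inball s e e0) (inball s' e e0).
  have [_ _ _ h _] := zP n; have := h u u' uz u'z.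
  have h1 := mdist_close s.1 s'.1 u.1 u'.1; have h2 := mdist_close s.2 s'.2 u.2 u'.2.
  apply/negP; rewrite -leNgt; move: u1 u2 u1' u2' h1 h2; rewrite /e /mXY /=.
  set A := mdist s.1 s'.1; set A' := mdist u.1 u'.1; set D := mdist s.2 s'.2.
  set D' := mdist u.2 u'.2 => u1 u2 u1' u2' h1 h2.
  have : (`|A - D| <= `|A - A'| + `|A' - D'| + `|D - D'|)%R.
    rewrite [X in (_ <= _ + X)%R]distrC.
    apply: le_trans (lerD (ler_normD _ _) (lexx _)); apply: le_trans (ler_normD _ _).
    by rewrite le_eqVlt; apply/orP; left; apply/eqP; congr (`| _ |)%R; ring.
  lra.
apply: ge_ereal_sup => _ [s hs <-].
rewrite lee_fin leNgt; apply/negP => lt_d.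
pose e := ((dXY s - c) / 2)%R.
have e0 : (0 < e)%R by rewrite divr_gt0// subr_gt0.
have [n [u [u' [uz _ [/= u1 u2] _]]]] := Psupp s s hs hs _ _ (oball s e) (oball s e)
  (inball s e e0) (inball s e e0).
have [_ _ _ _ h] := zP n; have := h u uz.
apply/negP; rewrite -leNgt.
have h1 := mdist_close (mm_map s.1) (mm_map s.2) (mm_map u.1) (mm_map u.2).
have h2 := mm_map_lip s.1 u.1; have h3 := mm_map_lip s.2 u.2.
move: h1; rewrite ler_norml => /andP[_ h1].
move: u1 u2 h1 h2 h3; rewrite /e /dXY; lra.
Qed.

End large_samples.
(** * The lower bound *)

Section representative_samples.
Context (R : realType) (B : polishType R) (X : mmField B) (I : countType).
Variable (a : nat -> X -> nat).
Hypothesis ma : forall k i, measurable ([set t | a k t = i] : set (borel X)).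
Variables (s : seq I) (us : uniq s) (s0 : (0 < size s)%N).

(** The weak law at precision [1 / (N + 1)], summed over the [N ^ 2] pairs of a
    level and a label. *)
Lemma representative_probability (N : nat) :
  1 - ((N.+1 ^ 4)%:R / (size s)%:R)%:E <=
    product_measure I (mm_measure X)
      [set x : I -> X | representative (mm_measure X) a N (map x s)] /\
  measurable ([set x : I -> X | representative (mm_measure X) a N (map x s)] :
    set (g_sigma_algebraType (@coordinate_cylinders I _ (borel X)))).
Proof.
pose CT := g_sigma_algebraType (@coordinate_cylinders I _ (borel X)).
pose P := product_measure I (mm_measure X).
pose n : R := (size s)%:R.
have n0 : (0 < n)%R by rewrite ltr0n.
have e0 : (0 < N.+1%:R^-1 :> R)%R by rewrite invr_gt0.
pose bad k i : set CT := [set x | (N.+1%:R^-1 <=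
  `|(count (fun j => x j \in [set t | a k t = i]) s)%:R / n -
    fine (mm_measure X [set t | a k t = i])|)%R].
have badP k i : measurable (bad k i) /\ P (bad k i) <= ((N.+1%:R^-1 ^+ 2 * n)^-1)%:E.
  exact: (weak_law (mm_measure X) (ma k i) us e0 s0).
pose badk k : set CT := \bigcup_(i in `I_N) bad k i.
have -> : [set x : I -> X | representative (mm_measure X) a N (map x s)] =
    ~` (\bigcup_(k in `I_N) badk k).
  apply/seteqP; split=> x /=.
    move=> rep [k /= kN [i /= iN]]; rewrite /bad/= leNgt => /negP; apply.
    by have := rep k i kN iN; rewrite /empirical size_map count_map.
  move=> nb k i kN iN; rewrite ltNge; apply/negP => hb; apply: nb.
  exists k => //; exists i => //.
  by move: hb; rewrite /empirical size_map count_map.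
have mU k : measurable (badk k).
  by apply: bigcup_measurable => i _; have [] := badP k i.
have mUU : measurable (\bigcup_(k in `I_N) badk k) by exact: bigcup_measurable.
split; last exact: measurableC.
rewrite probability_setC// leeB// bigcup_mkord.
apply: (le_trans (Boole_inequality P (fun k _ => mU k))).
apply: (@le_trans _ _ (\sum_(k < N) \sum_(i < N) ((N.+1%:R^-1 ^+ 2 * n)^-1)%:E)).
  apply: lee_sum => k _.
  rewrite /badk bigcup_mkord.
  apply: (le_trans (Boole_inequality P (fun i _ => (badP k i).1))).
  by apply: lee_sum => i _; exact: (badP k i).2.
under eq_bigr do rewrite sumEFin.
rewrite sumEFin lee_fin !sumr_const !card_ord.
rewrite -mulrnA -[leLHS]mulr_natr natrM natrX.
have -> : ((N.+1%:R^-1 ^+ 2 * n)^-1 * (N%:R * N%:R) = (N%:R * N.+1%:R) ^+ 2 / n :> R)%R.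
  by field; rewrite !gt_eqF.
rewrite ler_wpM2r ?invr_ge0 ?(ltW n0)// (exprM _ 2 2).
by rewrite ler_sqr ?nnegrE ?mulr_ge0// ler_wpM2r// ler_nat.
Qed.

End representative_samples.

Section neighborhoods.
Context (R : realType) (B : polishType R) (I : countType) (s : seq I) (e : R).

(** An open ball for the restriction of [rho] to the indices in [s], which is open
    in the product topology because [s] is finite. *)
Definition sup_close (r0 r : augmented B I) :=
  (forall ij, ij \in [seq (i, j) | i <- s, j <- s] ->
    (`|set_val r.1 ij - set_val r0.1 ij| < 2 * e)%R) /\
  (forall i, i \in s -> (mdist (r0.2 i) (r.2 i) < e)%R).

Lemma open_sup_close r0 : open [set r | sup_close r0 r].
Proof.
apply: openI; apply: open_all_seq => j.
  apply: (@open_comp (augmented B I) R (fun r => set_val r.1 j)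
    [set t | (`|t - set_val r0.1 j| < 2 * e)%R]).
    move=> r _; apply: (@continuous_comp _ _ _ fst (fun r : distmat R I => set_val r j)).
      exact: cvg_fst.
    exact: continuous_distmat_entry.
  rewrite (_ : [set _ | _] = ball (set_val r0.1 j : R) (2 * e)%R).
    exact: ball_open.
  by apply/seteqP; split=> t /=; rewrite -ball_normE/= distrC.
apply: (@open_comp (augmented B I) B (fun r => r.2 j) [set t | (mdist (r0.2 j) t < e)%R]).
  move=> r _; apply: (@continuous_comp _ _ _ snd (fun f : {ptws I -> B} => f j)).
    exact: cvg_snd.
  exact: (@proj_continuous _ (fun=> B) j).
exact: open_mball.
Qed.

End neighborhoods.

Section lower_bound.
Context (R : realType) (B : polishType R) (X Y : mmField B).

(** The set of matrices of points of [G] is the continuous image of a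
    measurable set and may fail to be measurable. Its [e]-neighbourhood on the
    indices in [s] is open and has at least the same mass. *)
Lemma dist_distribution_thicken (Z : mmField B) (I : countType) (s : seq I) (e : R)
    (G : set (I -> Z)) (q : \bar R) : (0 < e)%R ->
  measurable (G : set (g_sigma_algebraType (@coordinate_cylinders I _ (borel Z)))) ->
  q <= product_measure I (mm_measure Z) G ->
  exists U : set (augmented B I), [/\ open U, q <= dist_distribution Z U &
    forall r, U r -> exists2 x, G x & sup_close s e (augmented_dist x) r].
Proof.
move=> e0 mG qG.
pose U := \bigcup_(x in G) [set r | sup_close s e (augmented_dist x) r].
have oU : open U by apply: bigcup_open => x _; exact: open_sup_close.
exists U; split => //.
apply: (le_trans qG); rewrite /dist_distribution /pushforward.
apply: le_measure; rewrite ?inE//.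
  exact: (borel_preimage (@measurable_augmented_dist R B Z I) oU).
move=> x Gx; exists x => //; split=> [ij _|i _]; last by rewrite mdistxx.
by rewrite subrr normr0 mulr_gt0.
Qed.

(** Matrices close to those of representative samples of [X] and of [Y] have
    probability at least [1 - e] each, so at least [1 - 2 * e] jointly under any
    coupling; there [rho] is at least [c - 2 * e], by [representative_pairing] and
    the triangle inequality. *)
Lemma dW_ge (c e : R) : (0 < e)%R -> (2 * e <= c)%R -> c%:E < dGWoo X Y ->
  exists n, forall (I : countType) (s : seq I) (p : \bar R),
    uniq s -> (n <= size s)%N -> 1 <= p ->
    ((c - 2 * e) * (1 - 2 * e))%:E <= dW p I X Y.
Proof.
move=> e0 ec cGW.
have [aX [maX meshX]] := polish_labels X; have [aY [maY meshY]] := polish_labels Y.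
have [N hN] := representative_pairing maX maY meshX meshY cGW.
have [n hn] : exists n : nat, ((N.+1 ^ 4)%:R / e < n.+1%:R :> R)%R.
  by exists (Num.truncn ((N.+1 ^ 4)%:R / e : R)%R); exact: truncnS_gt.
exists n.+1 => I s p us ns p1.
have s0 : (0 < size s)%N by exact: leq_trans ns.
have small : (((N.+1 ^ 4)%:R / (size s)%:R) <= e :> R)%R.
  rewrite ler_pdivrMr ?ltr0n// mulrC -ler_pdivrMr//.
  by rewrite (le_trans (ltW hn))// ler_nat.
have thick (Z : mmField B) (a : nat -> Z -> nat)
    (ma : forall k i, measurable ([set t | a k t = i] : set (borel Z))) :
  exists U : set (augmented B I), [/\ open U, (1 - e)%:E <= dist_distribution Z U &
    forall r, U r -> exists2 x, representative (mm_measure Z) a N (map x s) &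
      sup_close s e (augmented_dist x) r].
  have [hP mP] := representative_probability ma us s0 N.
  apply: (dist_distribution_thicken s e0 mP).
  by apply: le_trans hP; rewrite -EFinB lee_fin lerD2l lerN2.
have [U [oU DU hU]] := thick X aX maX; have [V [oV DV hV]] := thick Y aY maY.
apply: le_ereal_inf_tmp => _ [Q [QX QY] <-].
pose AA : ptopologicalType := (augmented B I * augmented B I)%type.
have ofst : open (fst @^-1` U : set AA).
  by apply: open_comp oU => z _; exact: cvg_fst.
have osnd : open (snd @^-1` V : set AA).
  by apply: open_comp oV => z _; exact: cvg_snd.
have mfst : measurable (fst @^-1` U : set (borel AA)) by exact: open_borel.
have msnd : measurable (snd @^-1` V : set (borel AA)) by exact: open_borel.
pose E : set (borel AA) := fst @^-1` U `&` snd @^-1` V.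
have mE : measurable E by exact: measurableI.
have QE : (1 - 2 * e)%:E <= Q E.
  have h1 : (1 - e)%:E <= Q (fst @^-1` U) by rewrite QX//; exact: open_borel.
  have h2 : (1 - e)%:E <= Q (snd @^-1` V) by rewrite QY//; exact: open_borel.
  have h3 : Q (~` E) <= Q (~` (fst @^-1` U)) + Q (~` (snd @^-1` V)).
    by rewrite /E setCI; apply: measureU2; exact: measurableC.
  move: h3; rewrite !probability_setC//.
  move: h1 h2; rewrite -(fineK (fin_num_measure Q _ mfst)).
  rewrite -(fineK (fin_num_measure Q _ msnd)).
  rewrite -(fineK (fin_num_measure Q _ mE)) -!EFinB -EFinD !lee_fin; lra.
apply: (@le_trans _ _ ((c - 2 * e)%:E * Q E)).
  by rewrite EFinM lee_wpmul2l// lee_fin subr_ge0.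
apply: Lnorm_ge => //; first by rewrite subr_ge0.
  exact: measurable_rho.
move=> [r r'] [/= /hU[x rx [hx1 hx2]] /hV[y ry [hy1 hy2]]].
pose z := [seq (x i, y i) | i <- s].
have zX : map fst z = map x s by rewrite -map_comp.
have zY : map snd z = map y s by rewrite -map_comp.
have z0 : (0 < size z)%N by rewrite size_map.
have := hN z z0; rewrite zX zY => /(_ rx ry)[|].
  move=> [_ [_ [/mapP[i si ->] /mapP[j sj ->] hm]]].
  rewrite /rho le_max; apply/orP; left.
  rewrite lee_pdivlMl//; apply: le_ereal_sup_tmp.
  exists (`|set_val r.1 (i, j) - set_val r'.1 (i, j)|)%:E; first by exists (i, j).
  have sij : (i, j) \in [seq (i, j) | i <- s, j <- s] by apply/allpairsP; exists (i, j).
  have := hx1 _ sij; have := hy1 _ sij; move: hm; rewrite -EFinM lee_fin /mXY /=.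
  set A := mdist (x i) (x j); set D := mdist (y i) (y j).
  set A' := set_val r.1 _; set D' := set_val r'.1 _ => hm h1 h2.
  have : (`|A - D| <= `|A' - A| + `|A' - D'| + `|D' - D|)%R.
    rewrite [X in (_ <= X + _ + _)%R]distrC.
    apply: le_trans (lerD (ler_normD _ _) (lexx _)); apply: le_trans (ler_normD _ _).
    by rewrite le_eqVlt; apply/orP; left; apply/eqP; congr (`| _ |)%R; ring.
  by move: (ltW h1) (ltW h2) hm; lra.
move=> [_ /mapP[i si ->] hd].
rewrite /rho le_max; apply/orP; right.
apply: le_ereal_sup_tmp; exists (mdist (r.2 i) (r'.2 i))%:E; first by exists i.
have := hx2 _ si; have := hy2 _ si; rewrite lee_fin /=.
have := metric_triangle (mm_map (x i)) (r.2 i) (mm_map (y i)).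
have := metric_triangle (r.2 i) (r'.2 i) (mm_map (y i)).
rewrite (metric_sym (r'.2 i)); move: hd; rewrite /dXY /=; lra.
Qed.

Lemma dW_lower_bound (c : R) : c%:E < dGWoo X Y ->
  exists n, forall (I : countType) (s : seq I) (p : \bar R),
    uniq s -> (n <= size s)%N -> 1 <= p -> c%:E <= dW p I X Y.
Proof.
move=> cGW; have [c0|c0] := ltP c 0%R.
  exists 0%N => I s p _ _ _; apply: le_ereal_inf_tmp => _ [Q _ <-].
  by apply: le_trans (Lnorm_ge0 _ _ _); rewrite lee_fin ltW.
have [c' cc' c'GW] : exists2 c' : R, (c < c')%R & c'%:E < dGWoo X Y.
  case: (dGWoo X Y) cGW => [g|_|//].
    rewrite lte_fin => cg; exists ((c + g) / 2)%R; rewrite ?lte_fin; lra.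
  by exists (c + 1)%R; rewrite ?ltry// ltrDl.
(* With this e, (c' - 2 e) (1 - 2 e) >= c' - 2 e (1 + c') = c. *)
pose e := ((c' - c) / (2 * (1 + c')))%R.
have c'0 : (0 < 1 + c')%R by rewrite ltr_wpDr// (le_trans c0) ?ltW.
have eE : (2 * e * (1 + c') = c' - c)%R by rewrite /e; field; rewrite gt_eqF.
have e0 : (0 < e)%R by rewrite divr_gt0// ?subr_gt0// mulr_gt0.
have e1 : (2 * e <= c' - c)%R.
  rewrite -eE; apply: ler_peMr; first by rewrite mulr_ge0 ?(ltW e0).
  by rewrite lerDl (le_trans c0) ?ltW.
have [|n hn] := dW_ge e0 _ c'GW; first by rewrite (le_trans e1)// lerBlDr lerDl.
exists n => I s p us ns p1; apply: le_trans (hn I s p us ns p1).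
rewrite lee_fin; move: (sqr_ge0 e) eE => ee eE.
have -> : ((c' - 2 * e) * (1 - 2 * e) = c' - 2 * e * (1 + c') + 4 * e ^+ 2)%R by ring.
by rewrite eE opprB addrCA subrr addr0 lerDl mulr_ge0.
Qed.

(** Infinite matrices contain samples of any size, so [dW_lower_bound] applies
    with [s] an initial segment. *)
Lemma dW_nat_eq (p : \bar R) : 1 <= p -> dW p nat X Y = dGWoo X Y.
Proof.
move=> p1; apply/eqP; rewrite eq_le (dW_le_dGW _ _ 0%N)//= leNgt; apply/negP => lt_W.
have W0 : 0 <= dW p nat X Y by apply: le_ereal_inf_tmp => _ [Q _ <-]; exact: Lnorm_ge0.
have [c Wc cGW] : exists2 c : R, dW p nat X Y < c%:E & c%:E < dGWoo X Y.
  case: (dW p nat X Y) W0 lt_W => [w _|_|//]; last by rewrite ltNge leey.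
  case: (dGWoo X Y) => [g|_|//].
    rewrite lte_fin => wg; exists ((w + g) / 2)%R; rewrite lte_fin; lra.
  by exists (w + 1)%R; rewrite ?ltry// lte_fin ltrDl.
have [n hn] := dW_lower_bound cGW.
have := hn nat (iota 0 n) p (iota_uniq 0 n); rewrite size_iota => /(_ (leqnn n) p1).
by rewrite leNgt Wc.
Qed.

Lemma dW_ord_cvg (p : \bar R) : 1 <= p -> dW p 'I_n X Y @[n --> \oo] --> dGWoo X Y.
Proof.
move=> p1.
have lower (c : R) : c%:E < dGWoo X Y -> \forall n \near \oo, c%:E <= dW p 'I_n X Y.
  move=> /dW_lower_bound[n0 hn]; exists n0 => // n /= n0n.
  by apply: (hn _ (enum 'I_n)) => //; rewrite ?enum_uniq// size_enum_ord.
have upper : \forall n \near \oo, dW p 'I_n X Y <= dGWoo X Y.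
  exists 1%N => // -[//|n] _; exact: (dW_le_dGW _ _ ord0).
have GW0 : 0 <= dGWoo X Y.
  by rewrite -(dW_nat_eq p1); apply: le_ereal_inf_tmp => _ [Q _ <-]; exact: Lnorm_ge0.
case: (dGWoo X Y) GW0 lower upper => [g|_ lower _|//].
  move=> _ lower upper; apply/fine_cvgP.
  have fin : \forall n \near \oo, (g - 1)%:E <= dW p 'I_n X Y <= g%:E.
    have l1 : (g - 1)%:E < g%:E by rewrite lte_fin ltrBlDr ltrDl.
    near=> n; apply/andP; split; near: n; [exact: lower|exact: upper].
  split.
    near=> n.
    have /andP[h1 h2] : (g - 1)%:E <= dW p 'I_n X Y <= g%:E by near: n.
    by rewrite fin_numE -ltNye -ltey (lt_le_trans _ h1) ?ltNyr// (le_lt_trans h2) ?ltry.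
  apply/cvgrPdist_le => e e0; near=> n => /=.
  have /andP[h1 h2] : (g - e)%:E <= dW p 'I_n X Y <= g%:E.
    apply/andP; split; near: n; last exact: upper.
    by apply: lower; rewrite lte_fin ltrBlDr ltrDl.
  move: h1 h2; case: (dW p 'I_n X Y) => [w|//|//] /=; rewrite !lee_fin => h1 h2.
  by rewrite ger0_norm ?subr_ge0// lerBlDr -lerBlDl.
by apply/cvgeyPge => A; apply: lower; rewrite ltry.
Unshelve. all: by end_near. Qed.

End lower_bound.

Theorem theorem6p5 (R : realType) (B : polishType R) (X Y : mmField B)
    (p : \bar R) (bX : mm_bounded X) (bY : mm_bounded Y) (p1 : 1 <= p) :
  dW p 'I_n X Y @[n --> \oo] --> dW p nat X Y /\
  dW p nat X Y = dGWoo X Y.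
Proof. by rewrite (dW_nat_eq X Y p1); split => //; exact: dW_ord_cvg. Qed.
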